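(* Let $X=(X_t)_{t\ge0}$ be a real-valued Lévy process and, for $t>0$, $A_t=\int_0^t\mathbf 1\{X_s>0\}\,ds$. For every $m\ge1$ and $t>0$, $$\mathbb E[A_t^m]=\sum_{\rho\in\mathscr P_m}\int_0^t\Big(\mathop{\ast}_{B\in\rho}\big(u\mapsto u^{\#B-1}\,\mathbb P(X_u>0)\big)\Big)(s)\,ds.$$ In particular $\mathbb E[A_t]=\int_0^t\mathbb P(X_s>0)\,ds$ and $$\mathbb E[A_t^2]=\int_0^t s\,\mathbb P(X_s>0)\,ds+\int_0^t\int_0^s\mathbb P(X_u>0)\,\mathbb P(X_{s-u}>0)\,du\,ds.$$ These formulas remain valid if all strict inequalities (including the one in the definition of $A_t$) are replaced by weak inequalities.
   Context: A Lévy process is a càdlàg process with $X_0=0$ and stationary independent increments. $\mathscr P_m$ denotes the set of all partitions of $\{1,\dots,m\}$; $\#B$ is the cardinality of a block $B$. For $f,g:[0,\infty)\to\mathbb R$, $(f\ast g)(t)=\int_0^t f(t-s)g(s)\,ds$, and $\mathop{\ast}_{B\in\rho}$ denotes the iterated convolution over the blocks of $\rho$. *)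

(* Defs.v *)
From HB Require Import structures.
From mathcomp Require Import all_boot all_order all_algebra.
From mathcomp Require Import all_classical all_reals all_analysis.
Set Implicit Arguments.
Unset Strict Implicit.
Unset Printing Implicit Defensive.
Import Order.TTheory GRing.Theory Num.Theory.
Import numFieldNormedType.Exports.
Local Open Scope classical_set_scope.
Local Open Scope ring_scope.

Section levy.
Context {d : measure_display} {T : measurableType d} {R : realType}.

Definition levy_process (P : probability T R) (X : R -> T -> R) : Prop :=
  [/\ (forall t, 0 <= t -> measurable_fun setT (X t)) /\ (forall w, X 0 w = 0),
      (forall w t, 0 <= t -> X s w @[s --> t^'+] --> X t w /\
                             (0 < t -> cvg (X s w @[s --> t^'-]))),
      (forall s t (B : set R), 0 <= s -> s <= t -> measurable B ->
         P [set w | B (X t w - X s w)] = P [set w | B (X (t - s) w)]) &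
      (forall (n : nat) (tt : nat -> R) (B : nat -> set R),
         0 <= tt 0%N -> (forall i, (i < n)%N -> tt i < tt i.+1) ->
         (forall i, measurable (B i)) ->
         fine (P (\big[setI/setT]_(i < n)
                    [set w | B i (X (tt i.+1) w - X (tt i) w)]))
         = \prod_(i < n) fine (P [set w | B i (X (tt i.+1) w - X (tt i) w)]))].

Definition occupation_time (X : R -> T -> R) (p : R -> bool) (t : R) (w : T) : R :=
  Rintegral lebesgue_measure `[0, t] (fun s => (p (X s w))%:R).

Definition occ_moment (P : probability T R) (X : R -> T -> R) (p : R -> bool)
    (t : R) (m : nat) : \bar R :=
  (\int[P]_w ((occupation_time X p t w) ^+ m)%:E)%E.

End levy.

Definition conv {R : realType} (f g : R -> R) : R -> R :=
  fun t => Rintegral lebesgue_measure `[0, t] (fun s => f (t - s) * g s).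

(* iterated convolution of a (nonempty) list of functions;
   convolution is commutative and associative, so the order is irrelevant *)
Fixpoint bigconv {R : realType} (fs : seq (R -> R)) : R -> R :=
  match fs with
  | [::] => fun _ => 0
  | [:: f] => f
  | f :: fs' => conv f (bigconv fs')
  end.

Definition partition_formula {R : realType} (q : R -> R) (m : nat) (t : R) : R :=
  \sum_(rho : {set {set 'I_m}} | finset.partition rho [set: 'I_m])
    Rintegral lebesgue_measure `[0, t]
      (bigconv [seq (fun u => u ^+ (#|B| - 1)%N * q u) | B : {set 'I_m} <- enum rho]).

(* Main.v *)
Require Import Defs.
From HB Require Import structures.
From mathcomp Require Import all_boot all_order all_algebra.
From mathcomp Require Import all_classical all_reals all_analysis.
From mathcomp Require Import measurable_realfun ring lra.
Import Order.TTheory GRing.Theory Num.Theory.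
Import numFieldNormedType.Exports.
Local Open Scope classical_set_scope.
Local Open Scope ring_scope.

(* Attach to the process the measure N = du P(X_u in dx) on time x space,
   restricted to times in [0, b].  By stationarity and independence of the
   increments, its j-th convolution power is u^(j-1)/(j-1)! du P(X_u in dx).
   With I_n(s) = A_s^n / n!, the measures W_n = ds E[1{X_s > 0} I_(n-1)(s); X_s in dx]
   are obtained by alternately convolving with N and restricting to the
   half-space {x > 0} (Markov property), so they satisfy Spitzer's identity
     n W_n = sum_(1 <= j <= n) W_(n-j) * (N^{*j} restricted to x > 0),
   which only uses that the half-space and its complement are closed under
   addition.  Integrated in x, this becomes the recursion that removes the
   block of a fixed element from a set partition, and E[A_b^n] = n! W_n(1). *)

Set Implicit Arguments.
Unset Strict Implicit.

(** * Bounded measurable functions and finite measures *)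

(** Neither [W_n] nor the convolution powers of N are formed as measures: they act on bounded test
    functions of (time, position), and convolution enters through its adjoint [wconv]. Confining
    times to [0, b] keeps everything finite, so that Fubini applies to every bounded measurable
    integrand; test functions that vanish after b make the cut-off compatible with convolution. The
    difficulty in Spitzer's identity is that [W_n] is restricted to the half-space after every step,
    but a convolution power of N only once. Split each power into its parts on and off the
    half-space. Two parts on the same side convolve to something on that side, so after a final
    restriction the off-off terms vanish, and the mixed terms cancel when consecutive powers are
    paired. Multiplying the identity by (n-1)! gives the combinatorics: (n-1)! = C(n-1, j-1) (j-1)!
    (n-j)!, where C(n-1, j-1) counts the blocks of size j through a fixed element, (j-1)! cancels
    the denominator of the j-th power of N, and (n-j)! normalizes the remaining [W_(n-j)]. *)

Definition bounded_mfun {d} {S : measurableType d} {R : realType} (f : S -> R) :=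
  measurable_fun setT f /\ exists M, forall x, `|f x| <= M.

Section bounded_measurable.
Context {d : measure_display} {S : measurableType d} {R : realType}.
Implicit Types f g : S -> R.

Lemma bounded_mfun_cst (c : R) : bounded_mfun (fun _ : S => c).
Proof. by split => //; exists `|c|. Qed.

Lemma bounded_mfunD f g : bounded_mfun f -> bounded_mfun g ->
  bounded_mfun (fun x => f x + g x).
Proof.
move=> [mf [M fM]] [mg [N gN]]; split; first exact: measurable_funD.
by exists (M + N) => x; rewrite (le_trans (ler_normD _ _))// lerD.
Qed.

Lemma bounded_mfunN f : bounded_mfun f -> bounded_mfun (fun x => - f x).
Proof.
move=> [mf [M fM]]; split; first exact: measurable_funN.
by exists M => x; rewrite normrN.
Qed.

Lemma bounded_mfunM f g : bounded_mfun f -> bounded_mfun g ->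
  bounded_mfun (fun x => f x * g x).
Proof.
move=> [mf [M fM]] [mg [N gN]]; split; first exact: measurable_funM.
by exists (M * N) => x; rewrite normrM ler_pM.
Qed.

Lemma bounded_mfunX f n : bounded_mfun f -> bounded_mfun (fun x => f x ^+ n).
Proof.
move=> bf; elim: n => [|n IH]; first exact: bounded_mfun_cst.
by under eq_fun do rewrite exprS; exact: bounded_mfunM.
Qed.

Lemma bounded_mfun_bool (p : S -> bool) : measurable_fun setT p ->
  bounded_mfun (fun x => (p x)%:R : R).
Proof.
move=> mp; split.
  rewrite [X in measurable_fun _ X](_ : _ = fun x => if p x then 1 else 0).
    exact: measurable_fun_ifT.
  by apply/funext => x; case: (p x).
by exists 1 => x; case: (p x); rewrite ?normr1 ?normr0.
Qed.

Lemma bounded_mfun_comp d' (S' : measurableType d') f (g : S' -> S) :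
  bounded_mfun f -> measurable_fun setT g -> bounded_mfun (fun x => f (g x)).
Proof.
move=> [mf [M fM]] mg; split; first exact: measurableT_comp.
by exists M.
Qed.

Lemma bounded_mfun_integrable (mu : {finite_measure set S -> \bar R}) f :
  bounded_mfun f -> mu.-integrable setT (EFin \o f).
Proof.
move=> [mf [M fM]]; apply: measurable_bounded_integrable => //.
  by rewrite ltey_eq fin_num_measure.
by exists M; split; rewrite ?num_real// => x Mx y _; exact: le_trans (fM y) (ltW Mx).
Qed.

Section finite_measure_integral.
Variable mu : {finite_measure set S -> \bar R}.

Lemma bounded_EFin_Rintegral f : bounded_mfun f ->
  (\int[mu]_x f x)%:E = (\int[mu]_x (f x)%:E)%E.
Proof.
move=> bf; rewrite /Rintegral fineK//.
exact: integrable_fin_num (bounded_mfun_integrable mu bf).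
Qed.

Lemma bounded_RintegralD f g : bounded_mfun f -> bounded_mfun g ->
  \int[mu]_x (f x + g x) = \int[mu]_x f x + \int[mu]_x g x.
Proof. by move=> bf bg; rewrite RintegralD//; exact: bounded_mfun_integrable. Qed.

Lemma bounded_RintegralB f g : bounded_mfun f -> bounded_mfun g ->
  \int[mu]_x (f x - g x) = \int[mu]_x f x - \int[mu]_x g x.
Proof. by move=> bf bg; rewrite RintegralB//; exact: bounded_mfun_integrable. Qed.

Lemma bounded_RintegralZl c f : bounded_mfun f ->
  \int[mu]_x (c * f x) = c * \int[mu]_x f x.
Proof. by move=> bf; rewrite RintegralZl//; exact: bounded_mfun_integrable. Qed.

Lemma bounded_RintegralZr c f : bounded_mfun f ->
  \int[mu]_x (f x * c) = \int[mu]_x f x * c.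
Proof. by move=> bf; rewrite RintegralZr//; exact: bounded_mfun_integrable. Qed.

Lemma bounded_normr_Rintegral f M : bounded_mfun f -> (forall x, `|f x| <= M) ->
  `|\int[mu]_x f x| <= M * fine (mu setT).
Proof.
move=> bf fM; have [mf _] := bf.
rewrite (le_trans (le_normr_Rintegral _ _))//; first exact: bounded_mfun_integrable.
rewrite -(Rintegral_cst mu measurableT M) le_Rintegral//.
- apply: (@bounded_mfun_integrable mu (fun x => `|f x|)).
  by split; [exact: measurableT_comp|exists M => x; rewrite normr_id].
- exact: (bounded_mfun_integrable mu (bounded_mfun_cst M)).
Qed.

End finite_measure_integral.
End bounded_measurable.

Section measurable_terms.
Context {d d1 d2 : measure_display} {S : measurableType d}.
Context {S1 : measurableType d1} {S2 : measurableType d2} {R : realType}.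

Lemma measurable_fun_fst (f : S -> S1 * S2) : measurable_fun setT f ->
  measurable_fun setT (fun x => (f x).1).
Proof. exact: (measurableT_comp measurable_fst). Qed.

Lemma measurable_fun_snd (f : S -> S1 * S2) : measurable_fun setT f ->
  measurable_fun setT (fun x => (f x).2).
Proof. exact: (measurableT_comp measurable_snd). Qed.

Lemma bounded_mfun_comp2 (F : S1 -> S2 -> R) (f : S -> S1) (g : S -> S2) :
  bounded_mfun (fun z : S1 * S2 => F z.1 z.2) ->
  measurable_fun setT f -> measurable_fun setT g ->
  bounded_mfun (fun x => F (f x) (g x)).
Proof.
move=> bF mf mg.
by apply: (bounded_mfun_comp (g := fun x => (f x, g x)) bF); exact: measurable_fun_pair.
Qed.

End measurable_terms.

(** A placeholder, rebound once the paths are known to be jointly measurable, so that the two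
    solvers below then also handle terms [Y s w]. *)
Ltac measurable_hook := fail.

Ltac solve_measurable := repeat first
  [ assumption | exact: measurable_id | exact: measurable_cst
  | exact: measurable_fst | exact: measurable_snd
  | apply: measurable_fun_pair | apply: measurable_fun_fst | apply: measurable_fun_snd
  | apply: measurable_fun_ler | apply: measurable_fun_ltr | apply: measurable_fun_eqr
  | apply: measurable_and | apply: measurable_neg
  | apply: measurable_funB | apply: measurable_funD
  | match goal with H : measurable_fun setT ?f |- _ =>
      is_var f; apply: (measurableT_comp (f := f) H) end
  | measurable_hook ].

Ltac solve_bounded := repeat first
  [ assumption | exact: bounded_mfun_cst
  | apply: bounded_mfunM | apply: bounded_mfunD
  | apply: bounded_mfunN | apply: bounded_mfunX
  | match goal with H : bounded_mfun (fun z => ?F z.1 z.2) |- _ =>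
      apply: (bounded_mfun_comp2 (F := F) H) end
  | match goal with H : bounded_mfun ?f |- _ => apply: (bounded_mfun_comp (f := f) H) end
  | apply: bounded_mfun_bool ];
  solve_measurable.

Section fubini.
Context {d1 d2 : measure_display} {S1 : measurableType d1} {S2 : measurableType d2}.
Context {R : realType}.
Variables (F : S1 -> S2 -> R).
Hypothesis bF : bounded_mfun (fun z : S1 * S2 => F z.1 z.2).

Lemma bounded_mfun_slice1 x : bounded_mfun (F x).
Proof. exact: bounded_mfun_comp bF (pair1_measurable x). Qed.

Lemma bounded_mfun_slice2 y : bounded_mfun (F ^~ y).
Proof. exact: bounded_mfun_comp bF (pair2_measurable y). Qed.

Lemma bounded_mfun_integrable_prod (m1 : {finite_measure set S1 -> \bar R})
    (m2 : {finite_measure set S2 -> \bar R}) :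
  (m1 \x m2)%E.-integrable setT (fun z => (F z.1 z.2)%:E).
Proof.
case: bF => mF [M FM].
apply: measurable_bounded_integrable => //; last first.
  by exists M; split; rewrite ?num_real// => x Mx y _; exact: le_trans (FM y) (ltW Mx).
rewrite [X in (X < _)%E](_ : _ = (m1 setT * m2 setT)%E); last first.
  by rewrite -setXTT; exact: product_measure1E.
by rewrite ltey_eq fin_numM ?fin_num_measure.
Qed.

Lemma bounded_mfun_Rintegral (m2 : {finite_measure set S2 -> \bar R}) :
  bounded_mfun (fun x => \int[m2]_y F x y).
Proof.
split; last first.
  have [_ [M FM]] := bF; exists (M * fine (m2 setT)) => x.
  by apply: bounded_normr_Rintegral => [|y]; [exact: bounded_mfun_slice1|exact: (FM (x, y))].
apply/measurable_EFinP; rewrite [X in measurable_fun _ X](_ : _ =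
    fubini_F m2 (fun z => (F z.1 z.2)%:E)).
  (* The partial integral involves [m2] alone, but its measurability is stated under integrability
     for a product; a Dirac mass serves as the first factor. *)
  exact: measurable_fubini_F (bounded_mfun_integrable_prod (dirac point) m2).
apply/funext => x; rewrite /= /fubini_F /= bounded_EFin_Rintegral//.
exact: bounded_mfun_slice1.
Qed.

Lemma bounded_Rintegral_swap (m1 : {finite_measure set S1 -> \bar R})
    (m2 : {finite_measure set S2 -> \bar R}) :
  \int[m1]_x \int[m2]_y F x y = \int[m2]_y \int[m1]_x F x y.
Proof.
have /= FE := Fubini (bounded_mfun_integrable_prod m1 m2).
rewrite /Rintegral; congr fine.
rewrite (eq_integral (fun x => \int[m2]_y (F x y)%:E)%E) => [|x _]; last first.
  by rewrite -bounded_EFin_Rintegral//; exact: bounded_mfun_slice1.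
rewrite FE; apply: eq_integral => y _.
by rewrite -bounded_EFin_Rintegral//; exact: bounded_mfun_slice2.
Qed.

End fubini.

Section fubini4.
Context {d1 d2 d3 d4 : measure_display} {S1 : measurableType d1}
  {S2 : measurableType d2} {S3 : measurableType d3} {S4 : measurableType d4}.
Context {R : realType} (m1 : {finite_measure set S1 -> \bar R})
  (m2 : {finite_measure set S2 -> \bar R}) (m3 : {finite_measure set S3 -> \bar R})
  (m4 : {finite_measure set S4 -> \bar R}).

Lemma bounded_Rintegral_swap4 (F : S1 -> S2 -> S3 -> S4 -> R) :
  bounded_mfun (fun z : S1 * S2 * S3 * S4 => F z.1.1.1 z.1.1.2 z.1.2 z.2) ->
  \int[m1]_x \int[m2]_y \int[m3]_z \int[m4]_t F x y z t =
  \int[m3]_z \int[m4]_t \int[m1]_x \int[m2]_y F x y z t.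
Proof.
move=> bF.
have bFc d (S : measurableType d) (f1 : S -> S1) (f2 : S -> S2) (f3 : S -> S3) (f4 : S -> S4) :
    measurable_fun setT f1 -> measurable_fun setT f2 -> measurable_fun setT f3 ->
    measurable_fun setT f4 -> bounded_mfun (fun x => F (f1 x) (f2 x) (f3 x) (f4 x)).
  move=> *; apply: (bounded_mfun_comp (g := fun x => (f1 x, f2 x, f3 x, f4 x)) bF).
  by solve_measurable.
transitivity (\int[m1]_x \int[m3]_z \int[m2]_y \int[m4]_t F x y z t).
  apply: eq_Rintegral => x _.
  apply: (bounded_Rintegral_swap (F := fun y z => \int[m4]_t F x y z t)).
  apply: (bounded_mfun_Rintegral (F := fun z t => F x z.1 z.2 t)).
  by apply: bFc; solve_measurable.
rewrite (bounded_Rintegral_swap (F := fun x z => \int[m2]_y \int[m4]_t F x y z t)); last first.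
  apply: (bounded_mfun_Rintegral (F := fun z y => \int[m4]_t F z.1 y z.2 t)).
  apply: (bounded_mfun_Rintegral (F := fun z t => F z.1.1 z.2 z.1.2 t)).
  by apply: bFc; solve_measurable.
apply: eq_Rintegral => z _.
transitivity (\int[m1]_x \int[m4]_t \int[m2]_y F x y z t).
  apply: eq_Rintegral => x _; apply: bounded_Rintegral_swap.
  by apply: bFc; solve_measurable.
apply: (bounded_Rintegral_swap (F := fun x t => \int[m2]_y F x y z t)).
apply: (bounded_mfun_Rintegral (F := fun w y => F w.1 y z w.2)).
by apply: bFc; solve_measurable.
Qed.

End fubini4.

(** * Lebesgue measure on a segment *)

Section image_measure.
Context {d d' : measure_display} {S : measurableType d} {S' : measurableType d'}.
Context {R : realType} (mu : {finite_measure set S -> \bar R}) (f : S -> S').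
Hypothesis mf : measurable_fun setT f.

(** The measurability proof is an argument so that the measure and finiteness instances can be
    attached to the term itself. *)
Definition image_measure (_ : measurable_fun setT f) := pushforward mu f.
Local Notation nu := (image_measure mf).
Let push : {measure set S' -> \bar R} :=
  measure_function_pushforward__canonical__measure_function_Measure mu mf.

HB.instance Definition _ := isMeasure.Build _ _ _ nu (measure0 push)
  (measure_ge0 push) (@measure_semi_sigma_additive _ _ _ push).

Let nu_fin : fin_num_fun nu.
Proof.
by move=> A mA; apply: fin_num_measure; rewrite -[X in measurable X]setTI; exact: mf.
Qed.

HB.instance Definition _ := Measure_isFinite.Build _ _ _ nu nu_fin.

Lemma Rintegral_image_measure (g : S' -> R) : bounded_mfun g ->
  \int[nu]_y g y = \int[mu]_x g (f x).
Proof.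
move=> bg; have bgf := bounded_mfun_comp bg mf.
rewrite /Rintegral; congr fine.
have mg : measurable_fun setT (EFin \o g) by apply/measurable_EFinP; case: bg.
by rewrite (integral_pushforward mf mg)//; exact: bounded_mfun_integrable.
Qed.

End image_measure.

Section restricted_measure.
Context {d : measure_display} {S : measurableType d} {R : realType}.
Variables (mu : {measure set S -> \bar R}) (D : set S).
Hypotheses (mD : measurable D) (muD : (mu D < +oo)%E).

Lemma Rintegral_mfrestr (f : S -> R) : bounded_mfun f ->
  \int[mfrestr mD muD]_x f x = \int[mu]_(x in D) f x.
Proof.
move=> [mf _]; rewrite /Rintegral; congr fine.
transitivity (\int[mfrestr mD muD]_(x in D) (f x)%:E)%E.
  rewrite [RHS]integral_mkcond; apply: ae_eq_integral => //.
  - exact/measurable_EFinP.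
  - apply/(measurable_restrictT (EFin \o f)) => //.
    by apply/measurable_EFinP; exact: measurable_funTS.
  - exists (~` D); split; first exact: measurableC.
      by rewrite /= /mfrestr /mrestr setICl measure0.
    by move=> x /= + xD; apply => _; rewrite patchE mem_set.
apply: eq_measure_integral => A mA AD.
by rewrite /= /mfrestr /mrestr setIidl.
Qed.

End restricted_measure.

Section lebesgue_segment.
Context {R : realType}.

Lemma lebesgue_measure_segment_lty (b : R) : (lebesgue_measure `[0%R, b] < +oo)%E.
Proof. by rewrite lebesgue_measure_itv/=; case: ifP => //; rewrite -EFinB ltry. Qed.

Let restr (b : R) : {finite_measure set (measurableTypeR R) -> \bar R} :=
  @mfrestr _ (measurableTypeR R) R _ lebesgue_measure (measurable_itv `[0, b])
    (lebesgue_measure_segment_lty b).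

(* [lebesgue_measure] lives on [measurableTypeR R]; pushing it to [R] itself
   lets all the integrands be plain functions on [R]. *)
Definition lebesgue_segment (b : R) : {finite_measure set R -> \bar R} :=
  image_measure (f := fun x : measurableTypeR R => (x : R)) (restr b)
    (@measurable_id _ _ setT).

Variable b : R.
Local Notation lam := (lebesgue_segment b).

Lemma lebesgue_segmentE (f : R -> R) : bounded_mfun f ->
  \int[lam]_x f x = \int[lebesgue_measure]_(x in `[0, b]) f x.
Proof.
move=> bf; rewrite /lebesgue_segment Rintegral_image_measure//.
exact: Rintegral_mfrestr.
Qed.

Lemma eq_lebesgue_segment (f g : R -> R) : bounded_mfun f -> bounded_mfun g ->
  (forall x, 0 <= x <= b -> f x = g x) -> \int[lam]_x f x = \int[lam]_x g x.
Proof.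
move=> bf bg fg; rewrite !lebesgue_segmentE//; apply: eq_Rintegral => x.
by rewrite inE /= in_itv/=; exact: fg.
Qed.

Let transl (s : R) : measurableTypeR R -> measurableTypeR R := +%R s.

Let measurable_transl (s : R) : measurable_fun setT (transl s).
Proof. exact: (@measurable_funD _ _ _ setT (fun=> s) id). Qed.

Let lebesgue_measure_transl (s : R) (A : set (measurableTypeR R)) : measurable A ->
  pushforward lebesgue_measure (transl s) A = lebesgue_measure A.
Proof.
move=> mA; apply/esym/(lebesgue_measure_unique
  (mu := measure_function_pushforward__canonical__measure_function_Measure
    lebesgue_measure (measurable_transl s))) => //= _ [[x y]] _ <-.
rewrite /pushforward (_ : _ @^-1` _ = `]x - s, y - s]%classic); last first.
  by apply/seteqP; split => u /=; rewrite /transl !in_itv/= => /andP[? ?]; apply/andP; split; lra.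
rewrite !lebesgue_measure_itv/= !lte_fin ltrD2r; case: ifP => // _.
by rewrite -!EFinD; congr EFin; ring.
Qed.

(** The substitution v = s + u maps [0, b] onto [s, s + b]; since [g] is zero beyond b, only [s, b]
    contributes and the integral stays on the same segment. *)
Lemma lebesgue_segment_shift (s : R) (g : R -> R) : 0 <= s -> bounded_mfun g ->
  (forall v, b < v -> g v = 0) ->
  \int[lam]_u g (s + u) = \int[lam]_v ((s <= v)%R%:R * g v).
Proof.
move=> s0 bg gb; have [mg [M gM]] := bg.
have bgs : bounded_mfun (fun u => g (s + u)).
  by apply: (bounded_mfun_comp bg); solve_measurable.
rewrite !lebesgue_segmentE//; last by solve_bounded.
transitivity (\int[lebesgue_measure]_(v in `[s, s + b]) g v); last first.
  rewrite Rintegral_mkcond [RHS]Rintegral_mkcond; congr (Rintegral _ _ _).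
  apply/funext => v; rewrite !patchE; case: (lerP v b) => vb; last first.
    by rewrite gb// mulr0 !if_same.
  have [sv|vs] := lerP s v; last first.
    by rewrite mul0r if_same memNset//= in_itv/= => /andP[]; rewrite leNgt vs.
  by rewrite mul1r !mem_set//= in_itv/= ?vb ?sv ?andbT//=; lra.
rewrite /Rintegral; congr fine.
have sE : transl s @^-1` `[s, s + b] = `[0, b]%classic.
  by apply/seteqP; split => u /=; rewrite /transl !in_itv/= => /andP[? ?]; apply/andP; split; lra.
have mg' : measurable_fun [set: measurableTypeR R] (EFin \o g) by exact/measurable_EFinP.
have ig : lebesgue_measure.-integrable (transl s @^-1` `[s, s + b])
    ((EFin \o g) \o transl s).
  rewrite sE; apply: (@measurable_bounded_integrable _ _ _ _ (g \o transl s)) => //.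
  - exact: lebesgue_measure_segment_lty.
  - by apply: measurable_funTS; exact: measurableT_comp mg (measurable_transl s).
  - by exists M; split; rewrite ?num_real// => x Mx y _; exact: le_trans (gM _) (ltW Mx).
transitivity (\int[pushforward lebesgue_measure (transl s)]_(v in `[s, (s + b)%R]) (g v)%:E)%E.
  rewrite (integral_pushforward (measurable_transl s) mg' ig)// sE.
  by apply: eq_integral.
by apply: eq_measure_integral => A mA _; exact: lebesgue_measure_transl.
Qed.

Lemma lebesgue_segment_point (r : R) (g : R -> R) :
  \int[lam]_s ((s == r)%:R * g s) = 0.
Proof.
(* On the singleton [g] equals the constant [g r], which can be pulled out even when [g] is not
   measurable. *)
transitivity (\int[lam]_s (g r * (s == r)%:R)).
  by apply: eq_Rintegral => s _; case: eqVneq => [->|]; rewrite ?mul1r ?mulr1 ?mul0r ?mulr0.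
rewrite bounded_RintegralZl; last by solve_bounded.
rewrite lebesgue_segmentE; last by solve_bounded.
rewrite Rintegral_mkcond.
rewrite (_ : _ \_ _ = (fun x => (0 <= r <= b)%R%:R * ((fun _ : measurableTypeR R => 1 : R) \_ [set r]) x)); last first.
  apply/funext => x; rewrite !patchE !mem_setE/= !in_itv/= in_set1.
  by case: eqVneq => [->|_]; rewrite ?if_same ?mulr0// mulr1; case: ifP.
have [rb|rb] := boolP (0 <= r <= b); last first.
  by rewrite (eq_Rintegral _ (g := fun=> 0)) ?Rintegral_cst ?mul0r ?mulr0// => x _; rewrite mul0r.
under eq_Rintegral do rewrite mul1r.
by rewrite -Rintegral_mkcond Rintegral_set1 mulr0.
Qed.

Lemma lebesgue_segment_length (a : R) : 0 <= a <= b ->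
  \int[lam]_s (s <= a)%R%:R = a.
Proof.
move=> /andP[a0 ab]; rewrite lebesgue_segmentE; last by solve_bounded.
rewrite Rintegral_mkcond (_ : _ \_ _ = (fun _ : measurableTypeR R => 1 : R) \_ `[0, a]); last first.
  apply/funext => x; rewrite !patchE !mem_setE/= !in_itv/=.
  by case: (lerP 0 x) => //= x0; case: (lerP x a) => xa /=; rewrite ?if_same// (le_trans xa ab).
rewrite -Rintegral_mkcond Rintegral_cst// [X in fine X](lebesgue_measure_itv `[0, a])/= lte_fin.
by case: ltgtP a0 => //= [a0 _|<-]; rewrite ?subr0 mul1r.
Qed.

End lebesgue_segment.

(** * Integrals over ordered times *)

Section iterated_integral.
Context {R : realType}.
Variable b : R.
Local Notation lam := (lebesgue_segment b).

(** The integral of a product of n copies of [a] over the simplex of decreasing times below v. It is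
    used twice: with the indicator of [p (Y r w)] it is a power of the occupation time over n!, with
    a = 1 it is the density of a convolution power in time. *)
Fixpoint iterint (a : R -> R) (n : nat) (v : R) : R :=
  if n is n'.+1 then \int[lam]_s ((s <= v)%R%:R * a s * iterint a n' s) else 1.

Arguments iterint : simpl never.

Lemma iterint_succ (a : R -> R) n v :
  iterint a n.+1 v = \int[lam]_s ((s <= v)%R%:R * a s * iterint a n s).
Proof. by []. Qed.

Lemma bounded_iterint_param d (S : measurableType d) (a : R -> S -> R) n :
  bounded_mfun (fun z : R * S => a z.1 z.2) ->
  bounded_mfun (fun z : R * S => iterint (a ^~ z.2) n z.1).
Proof.
move=> ba; elim: n => [|n IH] /=; first exact: bounded_mfun_cst.
pose F (z : R * S) (s : R) := (s <= z.1)%R%:R * a s z.2 * iterint (a ^~ z.2) n s.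
suff : bounded_mfun (fun w : (R * S) * R => F w.1 w.2).
  by move=> bF; have := bounded_mfun_Rintegral bF lam.
apply: bounded_mfunM; first apply: bounded_mfunM; first by solve_bounded.
- by apply: (bounded_mfun_comp2 ba); solve_measurable.
- apply: (bounded_mfun_comp2 (F := fun s x => iterint (a ^~ x) n s) IH); solve_measurable.
Qed.

Lemma bounded_iterint (a : R -> R) n : bounded_mfun a -> bounded_mfun (iterint a n).
Proof.
move=> ba; apply: (bounded_mfun_comp2 (f := id) (g := fun=> tt)
  (F := fun v (_ : unit) => iterint a n v)) => //.
apply: (@bounded_iterint_param _ unit (fun s _ => a s)).
by apply: (bounded_mfun_comp ba); solve_measurable.
Qed.

(* Integration by parts: split the square [[0, v]^2] along its diagonal. *)
Lemma iterintS (a : R -> R) n v : bounded_mfun a ->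
  n.+1%:R * iterint a n.+1 v = iterint a 1 v * iterint a n v.
Proof.
move=> ba; elim: n v => [|n IH] v; first by rewrite mul1r mulr1.
have bi k : bounded_mfun (iterint a k) by exact: bounded_iterint.
(* [G1] is the part r <= s of the square, handled by the induction hypothesis; [G2] is the part s <=
   r, which is the next iterated integral; [G3] is the diagonal, counted twice and of measure
   zero. *)
pose G1 s r := (s <= v)%R%:R * a s * iterint a n s * ((r <= s)%R%:R * a r * 1).
pose G2 s r := (r <= v)%R%:R * a r * ((s <= r)%R%:R * a s * iterint a n s).
pose G3 s r := (r == s)%:R * ((s <= v)%R%:R * a s * a r * iterint a n s).
have bfst (f : R -> R) : bounded_mfun f -> bounded_mfun (fun z : R * R => f z.1).
  by move=> bf; apply: (bounded_mfun_comp bf).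
have bsnd (f : R -> R) : bounded_mfun f -> bounded_mfun (fun z : R * R => f z.2).
  by move=> bf; apply: (bounded_mfun_comp bf).
have [bin bin1] := (bi n, bi n.+1).
have [ba1 ba2 bi1] := And3 (bfst _ ba) (bsnd _ ba) (bfst _ (bi n)).
have bG1 : bounded_mfun (fun z => G1 z.1 z.2) by solve_bounded.
have bG2 : bounded_mfun (fun z => G2 z.1 z.2) by solve_bounded.
have bG3 : bounded_mfun (fun z => G3 z.1 z.2) by solve_bounded.
have G1E : \int[lam]_s \int[lam]_r G1 s r = n.+1%:R * iterint a n.+2 v.
  rewrite (iterint_succ _ n.+1) -bounded_RintegralZl; last by solve_bounded.
  apply: eq_Rintegral => s _; rewrite bounded_RintegralZl; last by solve_bounded.
  by rewrite -[Rintegral _ _ _]/(iterint a 1 s) mulrCA IH [iterint a 1 s * _]mulrC !mulrA.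
have G2E : \int[lam]_s \int[lam]_r G2 s r = iterint a n.+2 v.
  rewrite bounded_Rintegral_swap//; apply: eq_Rintegral => r _.
  by rewrite bounded_RintegralZl//; solve_bounded.
have G3E : \int[lam]_s \int[lam]_r G3 s r = 0.
  rewrite (eq_Rintegral _ (g := fun=> 0)) ?Rintegral_cst ?mul0r// => s _.
  exact: (lebesgue_segment_point b s (fun r => (s <= v)%R%:R * a s * a r * iterint a n s)).
rewrite mulrS mulrDl mul1r -{1}G2E -G1E -[LHS]subr0 -G3E.
rewrite -bounded_RintegralD; try exact: bounded_mfun_Rintegral.
rewrite -bounded_RintegralB; last 2 first.
- by apply: bounded_mfunD; exact: bounded_mfun_Rintegral.
- exact: bounded_mfun_Rintegral.
rewrite [in RHS]mulrC [iterint a n.+1 v]iterint_succ -bounded_RintegralZr; last by solve_bounded.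
apply: eq_Rintegral => s _.
have [bG1s bG2s bG3s] := And3 (bounded_mfun_slice1 bG1 s) (bounded_mfun_slice1 bG2 s) (bounded_mfun_slice1 bG3 s).
rewrite -bounded_RintegralD// -bounded_RintegralB//; last exact: bounded_mfunD.
rewrite [iterint a 1 v]iterint_succ -bounded_RintegralZl; last by solve_bounded.
apply: eq_Rintegral => r _; rewrite /G1 /G2 /G3 -[iterint a 0 r]/1.
have split_diag : (s <= v)%R%:R * (r <= v)%R%:R =
    (s <= v)%R%:R * (r <= s)%R%:R + (r <= v)%R%:R * (s <= r)%R%:R
    - (r == s)%:R * (s <= v)%R%:R :> R.
  case: (ltgtP r s) => [rs|rs|->]; rewrite /= ?mulr0 ?mulr1 ?mul0r ?mul1r ?addr0 ?add0r ?subr0.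
  - by have [sv|] := lerP s v; rewrite ?mul0r// (le_trans (ltW rs) sv) mulr1.
  - by have [rv|] := lerP r v; rewrite ?mulr0// (le_trans (ltW rs) rv) mulr1.
  - by rewrite addrK -natrM mulnb andbb.
transitivity (a r * a s * iterint a n s * ((s <= v)%R%:R * (r <= v)%R%:R)); last by ring.
by rewrite split_diag; ring.
Qed.

Lemma iterintE (a : R -> R) n v : bounded_mfun a ->
  iterint a n v = (iterint a 1 v) ^+ n / n`!%:R.
Proof.
move=> ba; elim: n => [|n IH]; first by rewrite expr0 fact0 divr1.
have n0 : n.+1%:R != 0 :> R by rewrite pnatr_eq0.
apply: (mulfI n0); rewrite iterintS// IH exprS factS natrM.
by rewrite [RHS]mulrCA invfM [X in _ = _ * X]mulrA mulfV// mul1r mulrA.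
Qed.

End iterated_integral.

Arguments iterint : simpl never.

(** * Lévy processes: measurability and independence *)

Section joint_measurability.
Context {d : measure_display} {W : measurableType d} {R : realType}.
Variable X : R -> W -> R.
Hypothesis mX : forall t, 0 <= t -> measurable_fun setT (X t).
Hypothesis rcX : forall w t, 0 <= t -> X s w @[s --> t^'+] --> X t w.

(** The first point of the grid of mesh 1/(n+1) strictly to the right of max(s, 0). Strictness
    matters because the right limit is taken over a punctured neighbourhood. *)
Let grid n (s : R) : R := (Num.truncn (Num.max s 0 * n.+1%:R)).+1%:R / n.+1%:R.

Let grid_bounds n s : Num.max s 0 < grid n s <= Num.max s 0 + n.+1%:R^-1.
Proof.
have n0 : 0 < n.+1%:R :> R by rewrite ltr0n.
have s0 : 0 <= Num.max s 0 * n.+1%:R by rewrite mulr_ge0// le_max lexx orbT.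
have /andP[h1 h2] := truncn_itv s0.
by rewrite /grid ltr_pdivlMr// h2/= ler_pdivrMr// mulrDl mulVf ?gt_eqF// -natr1 lerD2r.
Qed.

Let measurable_grid n : measurable_fun setT (fun z : R * W => X (grid n z.1) z.2).
Proof.
move=> _ B mB; rewrite setTI.
pose K k := [set z : R * W | (k%:R <= Num.max z.1 0 * n.+1%:R) && (Num.max z.1 0 * n.+1%:R < k.+1%:R)].
rewrite (_ : _ @^-1` B = \bigcup_k (K k `&` (X (k.+1%:R / n.+1%:R) \o snd) @^-1` B)).
  apply: bigcup_measurable => k _; apply: measurableI.
    have mm : measurable_fun [set: R * W] (fun z => Num.max z.1 0 * n.+1%:R).
      by apply: measurable_funM => //; apply: measurable_maxr; solve_measurable.
    rewrite -[K k]setTI.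
    have mK : measurable_fun [set: R * W]
      (fun z => (k%:R <= Num.max z.1 0 * n.+1%:R) && (Num.max z.1 0 * n.+1%:R < k.+1%:R)).
      by solve_measurable.
    exact: (mK measurableT [set true]).
  rewrite -[X in measurable X]setTI; apply: measurableT_comp => //.
  by apply: mX; rewrite divr_ge0.
apply/seteqP; split => [[s w]/= Bsw|[s w] [k _] [/= /truncn_def Kk]]; last first.
  by rewrite /= /grid Kk.
exists (Num.truncn (Num.max s 0 * n.+1%:R)) => //; split => //=.
by apply: truncn_itv; rewrite mulr_ge0// le_max lexx orbT.
Qed.

Lemma measurable_right_continuous_process :
  measurable_fun setT (fun z : R * W => X (Num.max z.1 0) z.2).
Proof.
apply: (measurable_fun_cvg measurable_grid) => -[s w] _ /=.
have s0 : 0 <= Num.max s 0 by rewrite le_max lexx orbT.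
apply: (cvg_at_rightP (X ^~ w) (Num.max s 0) _).1; first exact: rcX.
split => [n|]; first by have /andP[] := grid_bounds n s.
apply: (@squeeze_cvgr _ _ _ _ (fun=> Num.max s 0) (fun n => Num.max s 0 + n.+1%:R^-1)).
- by apply: nearW => n; have /andP[/ltW -> ->] := grid_bounds n s.
- exact: cvg_cst.
- rewrite -[X in _ --> X]addr0; apply: cvgD; first exact: cvg_cst.
  exact: cvg_harmonic.
Qed.

End joint_measurability.

(** * Finite-dimensional events and independence of the past *)

Section past_events.
Context {d : measure_display} {W : measurableType d} {R : realType}.
Variable Y : R -> W -> R.

(** Finite lists of constraints (time, set) replace the filtration: they suffice because the
    functionals of the past needed later are iterated integrals of indicators at single times. *)
Definition past_event (l : seq (R * set R)) : set W :=
  \big[setI/setT]_(c <- l) [set w | c.2 (Y c.1 w)].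

Definition before (s : R) (l : seq (R * set R)) :=
  all (fun c => (c.1 <= s) && `[< measurable c.2 >]) l.

Lemma measurable_past_event s l : (forall t, measurable_fun setT (Y t)) ->
  before s l -> measurable (past_event l).
Proof.
move=> mY; rewrite /past_event; elim: l => [|c l IH] /=; first by rewrite big_nil.
move=> /andP[/andP[_ /asboolP mc] bl]; rewrite big_cons; apply: measurableI.
  by rewrite -[X in measurable X]setTI; exact: mY.
exact: IH.
Qed.

End past_events.

Section independence_of_the_past.
Context {d : measure_display} {W : measurableType d} {R : realType}.
Variables (P : probability W R) (X : R -> W -> R).
Hypothesis mX : forall t, 0 <= t -> measurable_fun setT (X t).
Hypothesis X0 : forall w, X 0 w = 0.
Hypothesis indep_incr : forall (n : nat) (tt : nat -> R) (B : nat -> set R),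
  0 <= tt 0%N -> (forall i, (i < n)%N -> tt i < tt i.+1) ->
  (forall i, measurable (B i)) ->
  fine (P (\big[setI/setT]_(i < n) [set w | B i (X (tt i.+1) w - X (tt i) w)]))
  = \prod_(i < n) fine (P [set w | B i (X (tt i.+1) w - X (tt i) w)]).

Let mincr s t (B : set R) : 0 <= s -> 0 <= t -> measurable B ->
  measurable [set w | B (X t w - X s w)].
Proof.
move=> s0 t0 mB; rewrite -[X in measurable X]setTI.
by apply: (measurable_funB (mX t0) (mX s0)).
Qed.

Section grid.
Variables (n : nat) (tt : nat -> R).
Hypothesis tt0 : tt 0%N = 0.
Hypothesis tt_incr : forall i, (i <= n)%N -> tt i < tt i.+1.

Let tt_ge0 i : (i <= n.+1)%N -> 0 <= tt i.
Proof.
elim: i => [|i IH] ni; first by rewrite tt0.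
by rewrite (le_trans (IH (ltnW ni)))// ltW// tt_incr.
Qed.

Let rect (B : nat -> set R) : set W :=
  \big[setI/setT]_(i < n) [set w | B i (X (tt i.+1) w - X (tt i) w)].

Let G : set (set W) := [set rect B | B in [set B | forall i, measurable (B i)]].

Let G_setI : setI_closed G.
Proof.
move=> _ _ [B mB <-] [C mC <-]; exists (fun i => B i `&` C i).
  by move=> i; exact: measurableI.
by rewrite /rect -big_split/=.
Qed.

Let G_measurable : G `<=` measurable.
Proof.
move=> _ [B mB <-]; apply: bigsetI_measurable => i _; apply: mincr => //; apply: tt_ge0.
  exact: leqW (ltnW (ltn_ord i)).
exact: leqW (ltn_ord i).
Qed.

(** The hypothesis on increments gives the product formula on rectangles. These form a pi-system, so
    the measures A |-> P(A and F) and A |-> P(A) P(F) also agree on the sigma-algebra of the first n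
    increments. *)
Lemma grid_sigma_indep (C : set R) (A : set W) : measurable C -> <<s G >> A ->
  let F := [set w | C (X (tt n.+1) w - X (tt n) w)] in P (A `&` F) = (P A * P F)%E.
Proof.
move=> mC sGA F; have mF : measurable F by apply: mincr => //; exact: tt_ge0.
have PF0 : 0 <= fine (P F) by exact: fine_ge0.
pose m1 := mrestr P mF.
pose m2 := mscale (NngNum PF0) P.
have m2E B : m2 B = (P B * P F)%E.
  by rewrite /m2 /mscale/= fineK ?fin_num_measure// muleC.
rewrite -[LHS]/(m1 A) -m2E.
have HG : [set B | G B /\ B `<=` setT] = G.
  by apply/seteqP; split => [B []//|B GB]; split.
apply: (g_sigma_algebra_measure_unique_trace G setT) => //; rewrite ?HG//.
- by rewrite -[RHS]/(m2 setT) m2E /= /m1 /mrestr setTI probability_setT mul1e.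
- move=> _ [D mD <-]; rewrite -[RHS]/(m2 (rect D)) m2E /= /m1 /mrestr.
  pose D' i := if i == n then C else D i.
  have mD' i : measurable (D' i) by rewrite /D'; case: ifP.
  have D'n : D' n = C by rewrite /D' eqxx.
  have D'E (i : 'I_n) : D' i = D i by rewrite /D' ltn_eqF.
  have := @indep_incr n.+1 tt D'; rewrite tt0 lexx => /(_ erefl tt_incr mD').
  have := @indep_incr n tt D.
  rewrite tt0 lexx => /(_ erefl (fun i ni => tt_incr (ltnW ni)) mD) eD.
  rewrite !big_ord_recr/= D'n -/F.
  rewrite [X in P (X `&` _)](_ : _ = rect D); last by apply: eq_bigr => i _; rewrite D'E.
  rewrite [X in X * _](_ : _ = fine (P (rect D))); last first.
    by rewrite /rect eD; apply: eq_bigr => i _; rewrite D'E.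
  have mrD : measurable (rect D) by apply: G_measurable; exists D.
  move=> eF; rewrite -[LHS]fineK ?fin_num_measure//; last exact: measurableI.
  by rewrite eF EFinM !fineK// fin_num_measure.
- by rewrite /= /m1 /mrestr setTI (le_lt_trans (probability_le1 _ _))// ltry.
Qed.

(** A position on the grid is the sum of the increments leading to it, because the path starts at 0;
    this passes from increments to the positions that past events constrain. *)
Lemma grid_sigma_position k (B : set R) : (k <= n)%N -> measurable B ->
  <<s G >> [set w | B (X (tt k) w)].
Proof.
move=> kn mB.
suff mXk : measurable_fun [set: g_sigma_algebraType G] (X (tt k)).
  by have := mXk measurableT B mB; rewrite setTI.
elim: k kn => [|k IH] kn.
  by rewrite tt0 (_ : X 0 = fun=> 0)//; apply/funext => w; exact: X0.
rewrite (_ : X _ = fun w => X (tt k) w + (X (tt k.+1) w - X (tt k) w)); last first.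
  by apply/funext => w; rewrite addrC subrK.
apply: measurable_funD; first exact: IH (ltnW kn).
move=> _ C mC; rewrite setTI; apply: sub_sigma_algebra.
exists (fun i => if i == k then C else setT) => [i|]; first by case: ifP.
rewrite /rect (bigD1 (Ordinal kn))//= eqxx big1 ?setIT// => i ik.
have /negbTE ik' : i != k :> nat by apply: contra ik => /eqP ik; apply/eqP/val_inj.
by rewrite ik'.
Qed.

End grid.

Local Notation Y := (fun s => X (Num.max s 0)).

Lemma past_event_indep s u l (C : set R) : 0 <= s -> 0 <= u -> before s l ->
  measurable C ->
  let F := [set w | C (Y (s + u) w - Y s w)] in
  P (past_event Y l `&` F) = (P (past_event Y l) * P F)%E.
Proof.
move=> s0; rewrite le_eqVlt => /predU1P[<- sl mC|u0 sl mC] F.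
  (* For u = 0 the increment is 0, so the event is everything or empty; this case is treated apart
     because the grid must be strictly increasing. *)
  have [C0|C0] := pselect (C 0).
    rewrite (_ : F = setT) ?setIT ?probability_setT ?mule1//.
    by apply/seteqP; split => w //= _; rewrite /F/= addr0 subrr.
  rewrite (_ : F = set0) ?setI0 ?measure0 ?mule0//.
  by apply/seteqP; split => w //=; rewrite /F/= addr0 subrr.
(* The grid consists of the distinct positive times of [l] together with s, which is its last point;
   constraints at times <= 0 concern [X 0] and are read at grid index 0. *)
pose ts := sort <=%R (undup [seq r <- s :: map fst l | 0 < r]).
have ts_mem r : (r \in ts) = (0 < r) && (r \in s :: map fst l).
  by rewrite mem_sort mem_undup mem_filter.
have ts_path : path <%R 0 ts.
  rewrite lt_path_sortedE; apply/andP; split.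
    by apply/allP => r; rewrite ts_mem => /andP[].
  by rewrite sort_lt_sorted undup_uniq.
have ts_le r : r \in ts -> r <= s.
  rewrite ts_mem inE => /andP[_ /orP[/eqP -> //|/mapP[c cl ->]]].
  by move/allP : sl => /(_ _ cl) /andP[].
clearbody ts; have last_ts : last 0 ts = s.
  move: s0; rewrite le_eqVlt => /predU1P[s0|s0].
    case ets : ts => [|r ts'] //=.
    have rts : r \in ts by rewrite ets mem_head.
    by move: (ts_le _ rts); rewrite -s0 leNgt; move: rts; rewrite ts_mem => /andP[->].
  have /splitPr sts : s \in ts by rewrite ts_mem s0 mem_head.
  case: sts ts_path ts_le {ts_mem} => p [|r p'] ts_path ts_le; first by rewrite last_cat.
  have := ts_le r; rewrite mem_cat !inE eqxx !orbT => /(_ isT).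
  by move: ts_path; rewrite cat_path/= leNgt => /and4P[_ _ ->].
(* The default value of [nth] supplies the grid point after s, namely s + u. *)
pose n := size ts; pose tt := nth (s + u) (0 :: ts).
have ttn : tt n = s by rewrite /tt /n -last_nth.
have tt0 : tt 0%N = 0 by [].
have ttn1 : tt n.+1 = s + u by rewrite /tt nth_default.
have tt_incr i : (i <= n)%N -> tt i < tt i.+1.
  rewrite leq_eqVlt => /predU1P[->|ni]; first by rewrite ttn ttn1 ltrDl.
  by have /(pathP (s + u)) := ts_path; apply.
have -> : F = [set w | C (X (tt n.+1) w - X (tt n) w)].
  by rewrite /F ttn ttn1 (max_l s0) (max_l (addr_ge0 s0 (ltW u0))).
apply: (grid_sigma_indep tt0 tt_incr) => //.
rewrite /past_event big_seq; set G := (X in <<s X >>).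
apply: (@bigsetI_measurable _ (g_sigma_algebraType G)) => c cl.
have /andP[_ /asboolP mc] := allP sl _ cl.
have [c0|c0] := lerP c.1 0.
  by rewrite -tt0; exact: grid_sigma_position.
have cts : c.1 \in ts by rewrite ts_mem c0 inE map_f ?orbT.
rewrite -(nth_index (s + u) cts) -[nth _ _ _]/(tt (index c.1 ts).+1).
by apply: grid_sigma_position => //; rewrite /n index_mem.
Qed.

End independence_of_the_past.

(** The process frozen at its initial value for negative times is defined and jointly measurable on
    all of [R * W]; independence takes the only form used later, a past event against one further
    increment. *)
Record levy_like {d} {W : measurableType d} {R : realType} (P : probability W R)
    (Y : R -> W -> R) : Prop := LevyLike {
  measurable_levy : measurable_fun setT (fun z : R * W => Y z.1 z.2) ;
  levy_nonpos : forall s w, s <= 0 -> Y s w = 0 ;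
  levy_stationary : forall s u (B : set R), 0 <= s -> 0 <= u -> measurable B ->
    P [set w | B (Y (s + u) w - Y s w)] = P [set w | B (Y u w)] ;
  levy_indep : forall s u l (B : set R), 0 <= s -> 0 <= u -> before s l ->
    measurable B ->
    P (past_event Y l `&` [set w | B (Y (s + u) w - Y s w)]) =
      (P (past_event Y l) * P [set w | B (Y (s + u)%R w - Y s w)%R])%E }.

Lemma levy_process_levy_like {d} {W : measurableType d} {R : realType}
    (P : probability W R) (X : R -> W -> R) :
  levy_process P X -> levy_like P (fun s => X (Num.max s 0)).
Proof.
move=> [[mX X0] cadlag stat indep]; split.
- by apply: measurable_right_continuous_process => // w t /(cadlag w t)[].
- by move=> s w s0; rewrite max_r.
- move=> s u B s0 u0 mB; rewrite !max_l ?addr_ge0//.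
  by rewrite stat ?lerDl// addrAC subrr add0r.
- by move=> s u l B s0 u0 sl mB; exact: past_event_indep.
Qed.

Section markov.
Context {d : measure_display} {W : measurableType d} {R : realType}.
Variables (P : probability W R) (Y : R -> W -> R).
Hypothesis LY : levy_like P Y.
Let mY := measurable_levy LY.

Lemma measurable_levy_comp d' (S : measurableType d') (f : S -> R) (g : S -> W) :
  measurable_fun setT f -> measurable_fun setT g ->
  measurable_fun setT (fun x => Y (f x) (g x)).
Proof.
move=> mf mg; apply: (measurableT_comp (g := fun x => (f x, g x)) mY).
exact: measurable_fun_pair.
Qed.

Lemma measurable_levy_at s : measurable_fun setT (Y s).
Proof. exact: (measurable_levy_comp (f := fun=> s) (g := id)). Qed.

Let mYs := measurable_levy_at.

(** Under P restricted to the past event, the joint law of (Y_s, increment) is the product of the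
    law of Y_s there and the law of Y_u under P. *)
Lemma past_increment_integral l s u (h : R -> R -> R) : 0 <= s -> 0 <= u ->
  before s l -> bounded_mfun (fun z : R * R => h z.1 z.2) ->
  \int[P]_w (\1_(past_event Y l) w * h (Y s w) (Y (s + u) w - Y s w)) =
  \int[P]_w (\1_(past_event Y l) w * \int[P]_w' h (Y s w) (Y u w')).
Proof.
move=> s0 u0 sl bh.
have mA : measurable (past_event Y l) by exact: measurable_past_event sl.
have Aoo : (P (past_event Y l) < +oo)%E by rewrite (le_lt_trans (probability_le1 _ _))// ltry.
pose PA : {finite_measure set W -> \bar R} := mfrestr mA Aoo.
have PAE (f : W -> R) : bounded_mfun f -> \int[P]_w (\1_(past_event Y l) w * f w) = \int[PA]_w f w.
  move=> bf; rewrite Rintegral_mfrestr// [RHS]Rintegral_mkcond; congr Rintegral.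
  by apply/funext => w; rewrite patchE indicE; case: ifP; rewrite ?mul1r ?mul0r.
have mI : measurable_fun setT (fun w => Y (s + u) w - Y s w) by exact: measurable_funB.
have mZ : measurable_fun setT (fun w => (Y s w, Y (s + u) w - Y s w)) by exact: measurable_fun_pair.
rewrite PAE; last by solve_bounded.
rewrite PAE; last first.
  apply: (bounded_mfun_Rintegral (F := fun w w' => h (Y s w) (Y u w'))).
  by apply: (bounded_mfun_comp2 bh); apply: (measurableT_comp (mYs _)); solve_measurable.
pose m1 : {finite_measure set R -> \bar R} := image_measure PA (mYs s).
pose m2 : {finite_measure set R -> \bar R} := image_measure P (mYs u).
pose m12 : {finite_measure set (R * R)%type -> \bar R} := image_measure PA mZ.
transitivity (\int[m12]_z h z.1 z.2); first by rewrite Rintegral_image_measure.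
transitivity (\int[m1]_x \int[m2]_y h x y); last first.
  rewrite Rintegral_image_measure; last exact: bounded_mfun_Rintegral.
  apply: eq_Rintegral => w _; rewrite Rintegral_image_measure//.
  exact: bounded_mfun_slice1.
(* On a rectangle, the condition that Y_s lies in B is one more constraint, at time s, on the past
   event; independence and stationarity then give the product. *)
have mE : forall A, measurable A -> (m1 \x m2)%E A = m12 A.
  apply: product_measure_unique => B C mB mC.
  rewrite /m12 /m1 /m2 /= /image_measure /pushforward /PA/= /mfrestr /mrestr.
  have := levy_indep LY s0 u0 (l := (s, B) :: l) _ mC; rewrite /= lexx/= asboolT// => /(_ sl).
  rewrite /past_event !big_cons/= (levy_stationary LY s0 u0 mC) => <-.
  congr (P _); apply/seteqP; split => w /= [].
    by move=> [? ?] ?; split => //; split.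
  by move=> [? ?] ?; split => //; split.
rewrite /Rintegral; congr fine.
rewrite (eq_measure_integral (m1 \x m2)%E) => [|A mA' _]; last exact/esym/mE.
rewrite -(integral12_prod_meas1 (bounded_mfun_integrable_prod bh m1 m2)).
apply: eq_integral => x _.
by rewrite [RHS]bounded_EFin_Rintegral//; exact: bounded_mfun_slice1.
Qed.
End markov.

Ltac measurable_hook ::=
  match goal with LY : levy_like _ _ |- _ =>
    first [exact: (measurable_levy_at LY) | apply: (measurable_levy_comp LY)] end.

(** * The Markov property *)

Section markov_property.
Context {d : measure_display} {W : measurableType d} {R : realType}.
Variables (P : probability W R) (Y : R -> W -> R).
Hypothesis LY : levy_like P Y.
Variables (b : R) (p : R -> bool).
Hypothesis mp : measurable_fun setT p.
Local Notation lam := (lebesgue_segment b).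

Definition occ n s w : R := iterint b (fun r => (p (Y r w))%:R) n s.

Lemma bounded_occ n : bounded_mfun (fun z : R * W => occ n z.1 z.2).
Proof.
apply: (bounded_iterint_param b n (a := fun r w => (p (Y r w))%:R)).
apply: bounded_mfun_bool; apply: (measurableT_comp mp).
exact: measurable_levy LY.
Qed.

Lemma occS n s w : occ n.+1 s w = \int[lam]_r ((r <= s)%R%:R * (p (Y r w))%:R * occ n r w).
Proof. by []. Qed.

Lemma past_event_cons s (B : set R) l w :
  \1_(past_event Y ((s, B) :: l)) w = \1_B (Y s w) * \1_(past_event Y l) w :> R.
Proof. by rewrite /past_event big_cons indicI. Qed.

Lemma indic_positivity x : \1_[set x | p x] x = (p x)%:R :> R.
Proof. by rewrite indicE mem_setE. Qed.

(** The occupation functional depends on a whole path segment, but its outermost integration time t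
    can be pulled out of the expectation. The indicator at time t then becomes a new constraint of
    the past event, and the induction continues with fewer integrals. *)
Lemma occ_increment_integral n l r s u (h : R -> R -> R) :
  r <= s -> 0 <= s -> 0 <= u -> before s l ->
  bounded_mfun (fun z : R * R => h z.1 z.2) ->
  \int[P]_w (\1_(past_event Y l) w * occ n r w * h (Y s w) (Y (s + u) w - Y s w)) =
  \int[P]_w (\1_(past_event Y l) w * occ n r w * \int[P]_w' h (Y s w) (Y u w')).
Proof.
move=> rs s0 u0 + bh; elim: n r rs l => [|n IH] r rs l sl.
  under eq_Rintegral do rewrite mulr1.
  under [RHS]eq_Rintegral do rewrite mulr1.
  exact: (past_increment_integral LY).
(* Stated for a general factor [Z] because it is applied to both sides of the identity. *)
have step (Z : W -> R) : bounded_mfun Z ->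
    \int[P]_w (\1_(past_event Y l) w * occ n.+1 r w * Z w) =
    \int[lam]_t ((t <= r)%R%:R *
      \int[P]_w (\1_(past_event Y ((t, [set x | p x]) :: l)) w * occ n t w * Z w)).
  move=> bZ.
  have mA : measurable (past_event Y l) by apply: measurable_past_event sl => t; exact: (measurable_levy_at LY).
  have bA : bounded_mfun (\1_(past_event Y l) : W -> R).
    split; first exact: measurable_indic.
    by exists 1 => w; rewrite indicE; case: (_ \in _); rewrite ?normr1 ?normr0.
  have bo := bounded_occ n.
  transitivity (\int[P]_w \int[lam]_t ((t <= r)%R%:R *
      (\1_(past_event Y l) w * (p (Y t w))%:R * occ n t w * Z w))).
    apply: eq_Rintegral => w _; rewrite occS mulrAC -bounded_RintegralZl.
      by apply: eq_Rintegral => t _; ring.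
    by have bow := bounded_mfun_slice2 bo w; solve_bounded.
  rewrite (bounded_Rintegral_swap (F := fun (w : W) (t : R) => (t <= r)%R%:R *
      (\1_(past_event Y l) w * (p (Y t w))%:R * occ n t w * Z w))).
    apply: eq_Rintegral => t _; rewrite bounded_RintegralZl.
      by congr (_ * _); apply: eq_Rintegral => w _; rewrite past_event_cons indic_positivity; ring.
    by have bot := bounded_mfun_slice1 bo t; solve_bounded.
  by solve_bounded.
rewrite step; last by solve_bounded.
rewrite step; last first.
  apply: (bounded_mfun_Rintegral (F := fun w w' => h (Y s w) (Y u w'))).
  by solve_bounded.
apply: eq_Rintegral => t _; case: (lerP t r) => tr; last by rewrite !mul0r.
rewrite !mul1r; apply: IH; first exact: le_trans tr rs.
rewrite /= (le_trans tr rs)/= sl andbT; apply/asboolP.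
by have := mp measurableT (Y := [set true]); rewrite setTI; apply.
Qed.

End markov_property.

(** * Time-space measures as functionals *)

Section time_space_measures.
Context {d : measure_display} {W : measurableType d} {R : realType}.
Variables (P : probability W R) (Y : R -> W -> R).
Hypothesis LY : levy_like P Y.
Variables (b : R) (p : R -> bool).
Hypothesis mp : measurable_fun setT p.
Local Notation lam := (lebesgue_segment b).
Local Notation occ := (occ Y b p).
Implicit Types (k : R -> W -> R) (f g : R -> R -> R).

(** The test function [f] against the measure ds E[k(s); Y_s in dx] on [0, b] x R; the measure N of
    the overview has weight 1. *)
Definition wint k f : R := \int[lam]_s \int[P]_w (k s w * f s (Y s w)).
Definition shift2 f (s x : R) : R -> R -> R := fun u y => f (s + u) (x + y).
(** The adjoint of convolution: [wint k (wconv k' f)] integrates [f] against the convolution of the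
    measures of [k] and [k']. *)
Definition wconv k f : R -> R -> R := fun s x => wint k (shift2 f s x).
Definition bounded_fun2 f := bounded_mfun (fun z : R * R => f z.1 z.2).
Definition bounded_weight k := bounded_mfun (fun z : R * W => k z.1 z.2).
Definition vanishes_after f := forall s x, b < s -> f s x = 0.

Let bounded_wint_inner k f : bounded_weight k -> bounded_fun2 f ->
  bounded_mfun (fun s : R => \int[P]_w (k s w * f s (Y s w))).
Proof.
rewrite /bounded_weight /bounded_fun2 => bk bf.
by apply: (bounded_mfun_Rintegral (F := fun s w => k s w * f s (Y s w))); solve_bounded.
Qed.

Let bounded_section k f s : bounded_weight k -> bounded_fun2 f ->
  bounded_mfun (fun w => k s w * f s (Y s w)).
Proof.
move=> bk bf; have := bounded_mfun_slice1 bk s.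
by rewrite /bounded_fun2 in bf * => bks; solve_bounded.
Qed.

Lemma wint_eq k f k' f' : bounded_weight k -> bounded_fun2 f ->
  bounded_weight k' -> bounded_fun2 f' ->
  (forall s w, 0 <= s <= b -> k s w * f s (Y s w) = k' s w * f' s (Y s w)) ->
  wint k f = wint k' f'.
Proof.
move=> bk bf bk' bf' kf; apply: eq_lebesgue_segment => [||s sb]; try exact: bounded_wint_inner.
by apply: eq_Rintegral => w _; exact: kf.
Qed.

Lemma wintB k f f' : bounded_weight k -> bounded_fun2 f -> bounded_fun2 f' ->
  wint k (fun s x => f s x - f' s x) = wint k f - wint k f'.
Proof.
move=> bk bf bf'; rewrite /wint -bounded_RintegralB; try exact: bounded_wint_inner.
apply: eq_Rintegral => s _; rewrite -bounded_RintegralB.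
- by apply: eq_Rintegral => w _; rewrite mulrBr.
- exact: bounded_section.
- exact: bounded_section.
Qed.

Lemma wintDl k k' f : bounded_weight k -> bounded_weight k' -> bounded_fun2 f ->
  wint (fun s w => k s w + k' s w) f = wint k f + wint k' f.
Proof.
move=> bk bk' bf; rewrite /wint -bounded_RintegralD; try exact: bounded_wint_inner.
apply: eq_Rintegral => s _; rewrite -bounded_RintegralD; try exact: bounded_section.
by apply: eq_Rintegral => w _; rewrite mulrDl.
Qed.

Lemma wintZ k a f : bounded_weight k -> bounded_fun2 f ->
  wint k (fun s x => a * f s x) = a * wint k f.
Proof.
move=> bk bf; rewrite /wint -bounded_RintegralZl; last exact: bounded_wint_inner.
apply: eq_Rintegral => s _; rewrite -bounded_RintegralZl; last exact: bounded_section.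
by apply: eq_Rintegral => w _; rewrite mulrCA.
Qed.

Lemma bounded_shift2 f s x : bounded_fun2 f -> bounded_fun2 (shift2 f s x).
Proof. by rewrite /bounded_fun2 => bf; solve_bounded. Qed.

Lemma bounded_wconv k f : bounded_weight k -> bounded_fun2 f -> bounded_fun2 (wconv k f).
Proof.
rewrite /bounded_weight /bounded_fun2 => bk bf.
apply: (bounded_mfun_Rintegral (F := fun (z : R * R) s =>
  \int[P]_w (k s w * f (z.1 + s) (z.2 + Y s w)))).
apply: (bounded_mfun_Rintegral (F := fun (z : (R * R) * R) w =>
  k z.2 w * f (z.1.1 + z.2) (z.1.2 + Y z.2 w))).
by solve_bounded.
Qed.

Lemma wint_swap k k' f : bounded_weight k -> bounded_weight k' -> bounded_fun2 f ->
  wint k (wconv k' f) = wint k' (wconv k f).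
Proof.
rewrite /bounded_weight /bounded_fun2 => bk bk' bf.
pose F s w s' w' := k s w * (k' s' w' * f (s + s') (Y s w + Y s' w')).
transitivity (\int[lam]_s \int[P]_w \int[lam]_s' \int[P]_w' F s w s' w').
  apply: eq_Rintegral => s _; apply: eq_Rintegral => w _.
  rewrite -bounded_RintegralZl; last first.
    by apply: bounded_wint_inner => //; exact: bounded_shift2.
  apply: eq_Rintegral => s' _; rewrite -bounded_RintegralZl//.
  by apply: (bounded_section (f := shift2 f s (Y s w))) => //; exact: bounded_shift2.
rewrite bounded_Rintegral_swap4; last by solve_bounded.
apply: eq_Rintegral => s' _; apply: eq_Rintegral => w' _.
rewrite -bounded_RintegralZl; last first.
  by apply: bounded_wint_inner => //; exact: bounded_shift2.
apply: eq_Rintegral => s _; rewrite -bounded_RintegralZl; last first.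
  by apply: (bounded_section (f := shift2 f s' (Y s' w'))) => //; exact: bounded_shift2.
by apply: eq_Rintegral => w _; rewrite /F /shift mulrCA addrC [Y s w + _]addrC.
Qed.

Lemma bounded_occ_weight n g : bounded_fun2 g ->
  bounded_weight (fun s w => g s (Y s w) * occ n s w).
Proof.
rewrite /bounded_weight /bounded_fun2 => bg; have bo := bounded_occ LY b mp n.
by solve_bounded.
Qed.

(** Convolving with N appends an independent increment of length u to the path at time s. By the
    Markov property this is the same path seen at v = s + u, so the new weight at v collects the old
    weights at all s <= v. *)
Lemma markov_wint n g f : bounded_fun2 g -> bounded_fun2 f -> vanishes_after f ->
  wint (fun s w => g s (Y s w) * occ n s w) (wconv (fun _ _ => 1) f) =
  wint (fun v w => \int[lam]_s ((s <= v)%R%:R * (g s (Y s w) * occ n s w))) f.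
Proof.
move=> bg bf f0; have bk := bounded_occ_weight n bg.
have b1 : bounded_weight (fun _ _ => 1) by exact: bounded_mfun_cst.
have bo := bounded_occ LY b mp n.
pose k s w := g s (Y s w) * occ n s w.
pose phi s v := \int[P]_w (k s w * f v (Y v w)).
have bphi : bounded_mfun (fun z : R * R => phi z.1 z.2).
  rewrite /bounded_weight /bounded_fun2 in bk bf.
  apply: (bounded_mfun_Rintegral (F := fun (z : R * R) w => k z.1 w * f z.2 (Y z.2 w))).
  by apply: bounded_mfunM; [apply: (bounded_mfun_comp2 bk)|apply: (bounded_mfun_comp2 bf)];
    solve_measurable.
transitivity (\int[lam]_s \int[lam]_v ((s <= v)%R%:R * phi s v)).
  apply: eq_lebesgue_segment => [||s /andP[s0 sb]].
  - by apply: bounded_wint_inner => //; exact: bounded_wconv.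
  - by apply: (bounded_mfun_Rintegral (F := fun (s v : R) => (s <= v)%R%:R * phi s v)); solve_bounded.
  have bphis := bounded_mfun_slice1 bphi s.
  (* The substitution v = s + u; [phi s] vanishes after b because [f] does. *)
  rewrite -(lebesgue_segment_shift s0 bphis) => [|v bv]; last first.
    rewrite /phi (eq_Rintegral _ (g := fun=> 0)) ?Rintegral_cst ?mul0r// => w _.
    by rewrite f0// mulr0.
  have bks := bounded_mfun_slice1 bk s.
  pose psi u := \int[P]_w (k s w * \int[P]_w' f (s + u) (Y s w + Y u w')).
  have bpsi : bounded_mfun psi.
    rewrite /bounded_fun2 in bf.
    apply: (bounded_mfun_Rintegral (F := fun u w => k s w * \int[P]_w' f (s + u) (Y s w + Y u w'))).
    apply: bounded_mfunM; first by apply: (bounded_mfun_comp bks); solve_measurable.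
    apply: (bounded_mfun_Rintegral (F := fun z w' => f (s + z.1) (Y s z.2 + Y z.1 w'))).
    by solve_bounded.
  transitivity (\int[lam]_u psi u).
    transitivity (\int[P]_w \int[lam]_u (k s w * \int[P]_w' f (s + u) (Y s w + Y u w'))).
      apply: eq_Rintegral => w _; rewrite -bounded_RintegralZl.
        apply: eq_Rintegral => u _; congr (_ * _).
        by apply: eq_Rintegral => w' _; rewrite mul1r.
      have := bounded_wint_inner b1 (bounded_shift2 s (Y s w) bf).
      by under eq_fun do under eq_Rintegral do rewrite mul1r.
    rewrite (bounded_Rintegral_swap (F := fun w u =>
      k s w * \int[P]_w' f (s + u) (Y s w + Y u w')))//.
    rewrite /bounded_fun2 in bf.
    apply: bounded_mfunM; first by apply: (bounded_mfun_comp bks); solve_measurable.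
    apply: (bounded_mfun_Rintegral (F := fun z w' => f (s + z.2) (Y s z.1 + Y z.2 w'))).
    by solve_bounded.
  apply: eq_lebesgue_segment => [//||u /andP[u0 _]].
    by apply: (bounded_mfun_comp bphis); solve_measurable.
  (* In this function of position and increment, x + y becomes Y_(s+u) on the actual path. The list
     [[::]] below makes the past event the whole space. *)
  have bh : bounded_fun2 (fun x y => g s x * f (s + u) (x + y)).
    by rewrite /bounded_fun2 in bg bf *; solve_bounded.
  have := occ_increment_integral LY b mp n (l := [::]) (lexx s) s0 u0 isT bh.
  rewrite /past_event big_nil indicT => occE.
  transitivity (\int[P]_w (cst 1 w * occ n s w * (g s (Y s w) * f (s + u) (Y s w + (Y (s + u) w - Y s w))))).
    rewrite occE; apply: eq_Rintegral => w _; rewrite bounded_RintegralZl.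
      by rewrite /k/=; ring.
    by rewrite /bounded_fun2 in bf; solve_bounded.
  by apply: eq_Rintegral => w _; rewrite /k/= [Y s w + _]addrC subrK; ring.
rewrite (bounded_Rintegral_swap (F := fun (s v : R) => (s <= v)%R%:R * phi s v)); last by solve_bounded.
apply: eq_Rintegral => v _.
rewrite /bounded_weight /bounded_fun2 in bk bf.
have bkE : bounded_mfun (fun z : R * W => (z.1 <= v)%R%:R * (k z.1 z.2 * f v (Y v z.2))).
  apply: bounded_mfunM; first by solve_bounded.
  by apply: bounded_mfunM; [exact: bk|solve_bounded].
transitivity (\int[lam]_s \int[P]_w ((s <= v)%R%:R * (k s w * f v (Y v w)))).
  apply: eq_Rintegral => s _; rewrite bounded_RintegralZl//.
  have bks := bounded_mfun_slice1 (F := k) bk s.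
  by apply: bounded_mfunM; [exact: bks|solve_bounded].
rewrite (bounded_Rintegral_swap (F := fun (s : R) w => (s <= v)%R%:R * (k s w * f v (Y v w))))//.
apply: eq_Rintegral => w _; rewrite -bounded_RintegralZr.
  by apply: eq_Rintegral => s _; rewrite mulrA.
have bkw := bounded_mfun_slice2 (F := k) bk w.
by apply: bounded_mfunM; [solve_bounded|exact: bkw].
Qed.

End time_space_measures.

(** * Spitzer identity *)

Section spitzer_identity.
Context {d : measure_display} {W : measurableType d} {R : realType}.
Variables (P : probability W R) (Y : R -> W -> R).
Hypothesis LY : levy_like P Y.
Variables (b : R) (p : R -> bool).
Hypothesis b0 : 0 <= b.
Hypothesis mp : measurable_fun setT p.
Hypothesis pD : forall x y, p x -> p y -> p (x + y).
Hypothesis npD : forall x y, ~~ p x -> ~~ p y -> ~~ p (x + y).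
Local Notation lam := (lebesgue_segment b).
Local Notation occ := (occ Y b p).
Local Notation wint := (wint P Y b).
Local Notation wconv := (wconv P Y b).
Implicit Types (k : R -> W -> R) (f g : R -> R -> R).

Let one : R -> W -> R := fun _ _ => 1.
Let pos k s w : R := (p (Y s w))%:R * k s w.
Let neg k s w : R := (~~ p (Y s w))%:R * k s w.
(** On [0, b] this is s^j / j!, the weight of the convolution power of N of order j + 1: indices are
    one below those of the overview. *)
Definition pow_weight j : R -> W -> R := fun s _ => iterint b (fun=> 1) j s.
Local Notation c := pow_weight.
Let restr f s x : R := f s x * (p x)%:R.

Definition pos_weight j := pos (c j).

(** The measure [W_n] as a functional. The latest of the n times carries the restriction to [p],
    which leaves [occ n'] for the others; [W_0] is the unit mass at time 0 and position 0. *)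
Definition occ_functional n f : R :=
  if n is n'.+1 then wint (pos (occ n')) f else f 0 0.
Local Notation occF := occ_functional.
Arguments occ_functional : simpl never.

Lemma occ_functional0 f : occF 0 f = f 0 0. Proof. by []. Qed.

Lemma occ_functionalS n f : occF n.+1 f = wint (pos (occ n)) f. Proof. by []. Qed.

Lemma bounded_pow_weight j : bounded_weight (c j).
Proof.
have := bounded_iterint b j (bounded_mfun_cst 1).
by rewrite /bounded_weight /c => bi; solve_bounded.
Qed.

Let bounded_occ_w n : bounded_weight (occ n). Proof. exact: (bounded_occ LY b mp n). Qed.

Let bounded_one : bounded_weight one. Proof. exact: bounded_mfun_cst. Qed.

Let bounded_pos k : bounded_weight k -> bounded_weight (pos k).
Proof. by rewrite /bounded_weight => bk; solve_bounded. Qed.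

Let bounded_neg k : bounded_weight k -> bounded_weight (neg k).
Proof. by rewrite /bounded_weight => bk; solve_bounded. Qed.

Lemma bounded_pos_weight j : bounded_weight (pos_weight j).
Proof. exact/bounded_pos/bounded_pow_weight. Qed.

Let bounded_restr f : bounded_fun2 f -> bounded_fun2 (restr f).
Proof. by rewrite /bounded_fun2 => bf; solve_bounded. Qed.

Let vanishes_restr f : vanishes_after b f -> vanishes_after b (restr f).
Proof. by move=> f0 s x bs; rewrite /restr f0 ?mul0r. Qed.

Lemma vanishes_shift2 f s x : 0 <= s -> vanishes_after b f -> vanishes_after b (shift2 f s x).
Proof. by move=> s0 f0 u y bu; rewrite /shift2 f0//; lra. Qed.

Let wint0 k : wint k (fun _ _ => 0) = 0.
Proof.
rewrite /wint (eq_Rintegral _ (g := fun=> 0)) ?Rintegral_cst ?mul0r// => s _.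
by rewrite (eq_Rintegral _ (g := fun=> 0)) ?Rintegral_cst ?mul0r// => w _; rewrite mulr0.
Qed.

Let bounded_zero2 : bounded_fun2 (fun _ _ => 0 : R).
Proof. exact: bounded_mfun_cst. Qed.

Lemma vanishes_wconv k f : bounded_weight k -> bounded_fun2 f ->
  vanishes_after b f -> vanishes_after b (wconv k f).
Proof.
move=> bk bf f0 s x bs; rewrite /wconv -[RHS](wint0 k).
apply: wint_eq => //; first exact: bounded_shift2.
by move=> u w /andP[u0 ub]; rewrite /shift2 f0//; lra.
Qed.

Let wint_eqr k f f' : bounded_weight k -> bounded_fun2 f -> bounded_fun2 f' ->
  (forall s w, 0 <= s <= b -> k s w * f s (Y s w) = k s w * f' s (Y s w)) ->
  wint k f = wint k f'.
Proof. by move=> bk bf bf' ff'; exact: wint_eq. Qed.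

Let wint_split k f : bounded_weight k -> bounded_fun2 f ->
  wint k f = wint (pos k) f + wint (neg k) f.
Proof.
move=> bk bf; rewrite -(wintDl LY b (bounded_pos bk) (bounded_neg bk) bf).
suff {1}-> : k = fun s w => pos k s w + neg k s w by [].
apply/funext => s; apply/funext => w; rewrite /pos /neg -mulrDl.
by case: (p _); rewrite ?addr0 ?add0r mul1r.
Qed.

Let wint_pos_eq k f f' : bounded_weight k -> bounded_fun2 f -> bounded_fun2 f' ->
  (forall s x, 0 <= s <= b -> p x -> f s x = f' s x) ->
  wint (pos k) f = wint (pos k) f'.
Proof.
move=> bk bf bf' ff'; apply: wint_eqr => //; first exact: bounded_pos.
by move=> s w sb; rewrite /pos; case: (boolP (p _)) => [/ff' ->|]; rewrite ?mul0r.
Qed.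

Let wint_neg_eq k f f' : bounded_weight k -> bounded_fun2 f -> bounded_fun2 f' ->
  (forall s x, 0 <= s <= b -> ~~ p x -> f s x = f' s x) ->
  wint (neg k) f = wint (neg k) f'.
Proof.
move=> bk bf bf' ff'; apply: wint_eqr => //; first exact: bounded_neg.
by move=> s w sb; rewrite /neg; case: (boolP (p _)) => [|/ff' ->]; rewrite ?mul0r.
Qed.

Let wint_neg_restr k f : bounded_weight k -> bounded_fun2 f -> wint (neg k) (restr f) = 0.
Proof.
move=> bk bf; rewrite -[RHS](wint0 (neg k)); apply: wint_neg_eq => //; first exact: bounded_restr.
by move=> s x _ /negbTE npx; rewrite /restr npx mulr0.
Qed.

Let wint_pos_restr k f : bounded_weight k -> bounded_fun2 f ->
  wint (pos k) (restr f) = wint (pos k) f.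
Proof.
move=> bk bf; apply: wint_pos_eq => //; first exact: bounded_restr.
by move=> s x _ px; rewrite /restr px mulr1.
Qed.

Let shift20 f : shift2 f 0 0 = f.
Proof. by apply/funext => s; apply/funext => x; rewrite /shift2 !add0r. Qed.

Let shift2_wconv k f s x : shift2 (wconv k f) s x = wconv k (shift2 f s x).
Proof.
apply/funext => u; apply/funext => y; rewrite /shift2 /wconv /shift2.
by under eq_fun do under eq_fun do rewrite -!addrA.
Qed.

Lemma occ_functional_eq n f f' : bounded_fun2 f -> bounded_fun2 f' ->
  (forall s x, 0 <= s <= b -> f s x = f' s x) -> occF n f = occF n f'.
Proof.
move=> bf bf' ff'; case: n => [|n]; rewrite ?occ_functional0 ?occ_functionalS.
  by apply: ff'; rewrite lexx.
by apply: wint_pos_eq => // s x sb _; exact: ff'.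
Qed.

Lemma occ_functionalB n f f' : bounded_fun2 f -> bounded_fun2 f' ->
  occF n (fun s x => f s x - f' s x) = occF n f - occF n f'.
Proof. by move=> bf bf'; case: n => [//|n]; rewrite !occ_functionalS; apply: (wintB LY) => //; exact: bounded_pos. Qed.

(** By the Markov property, [W_n] convolved with N has weight [occ n]; its part on [p] is the next
    [W], and the rest is kept as an error term that dies on restricted test functions. *)
Let occF_step n f : bounded_fun2 f -> vanishes_after b f ->
  occF n (wconv one f) = occF n.+1 f + wint (neg (occ n)) f.
Proof.
move=> bf f0; rewrite occ_functionalS -wint_split//; case: n => [|n].
  by rewrite occ_functional0 /wconv shift20.
rewrite occ_functionalS.
have bg : bounded_fun2 (fun _ x => (p x)%:R : R).
  by rewrite /bounded_fun2; solve_bounded.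
apply: etrans (markov_wint LY mp n bg bf f0) _.
suff -> : occ n.+1 = fun v w => \int[lam]_s ((s <= v)%R%:R * ((p (Y s w))%:R * occ n s w)) by [].
by apply/funext => v; apply/funext => w; rewrite occS; apply: eq_Rintegral => s _; rewrite mulrA.
Qed.

Let wint_pow_step j f : bounded_fun2 f -> vanishes_after b f ->
  wint (c j) (wconv one f) = wint (c j.+1) f.
Proof.
move=> bf f0.
(* The weight does not depend on the path, so it is read off at an arbitrary path and passed to the
   Markov step as a function of time only, with [occ 0] = 1. *)
have bg : bounded_fun2 (fun s _ => c j s point).
  have := bounded_iterint b j (bounded_mfun_cst 1).
  by rewrite /bounded_fun2 /c => bi; solve_bounded.
have e1 : c j = fun s w => c j s point * occ 0 s w.
  by apply/funext => s; apply/funext => w; rewrite mulr1.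
have e2 : c j.+1 = fun v w => \int[lam]_s ((s <= v)%R%:R * (c j s point * occ 0 s w)).
  by apply/funext => v; apply/funext => w; apply: eq_Rintegral => s _; rewrite !mulr1.
apply: etrans (congr1 (fun k => wint k (wconv one f)) e1) _.
apply: etrans (markov_wint LY mp 0 bg bf f0) _.
exact: (congr1 (fun k => wint k f) (esym e2)).
Qed.

Let wconv_pow_step n j f : bounded_fun2 f -> vanishes_after b f ->
  occF n (wconv (c j.+1) f) = occF n (wconv (c j) (wconv one f)).
Proof.
have bc := bounded_pow_weight.
move=> bf f0; apply: occ_functional_eq; [exact: bounded_wconv|do 2 apply: bounded_wconv => //|].
move=> s x /andP[s0 _]; rewrite {1 2}/wconv shift2_wconv wint_pow_step//.
- exact: bounded_shift2.
- exact: vanishes_shift2.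
Qed.

Let wconv_commute k f : bounded_weight k -> bounded_fun2 f ->
  wconv one (wconv k f) = wconv k (wconv one f).
Proof.
move=> bk bf; apply/funext => s; apply/funext => x.
rewrite {1 3}/wconv !shift2_wconv; apply: wint_swap => //; exact: bounded_shift2.
Qed.

(** Both measures live where [p] holds, and so does their convolution as [p] is closed under
    addition. The alternative x = 0 covers [W_0], whose position may or may not satisfy [p]. *)
Let occF_pos_restr n j f : bounded_fun2 f ->
  occF n (wconv (pos_weight j) f) = occF n (wconv (pos_weight j) (restr f)).
Proof.
move=> bf; have bc := bounded_pow_weight j.
have brf := bounded_restr bf.
have E s x : x = 0 \/ p x -> wconv (pos_weight j) f s x = wconv (pos_weight j) (restr f) s x.
  move=> px; apply: (wint_pos_eq bc (bounded_shift2 s x bf) (bounded_shift2 s x brf)).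
  move=> u y _ py; rewrite /shift2 /restr.
  by case: px => [->|px]; rewrite ?add0r ?py ?pD// mulr1.
case: n => [|n]; first by rewrite !occ_functional0; apply: E; left.
have bA := bounded_pos_weight j.
rewrite !occ_functionalS; apply: (wint_pos_eq (bounded_occ_w n)
  (bounded_wconv LY b bA bf) (bounded_wconv LY b bA brf)) => s x _ px.
by apply: E; right.
Qed.

Let wconv_neg_restr j f s x : bounded_fun2 f -> x = 0 \/ ~~ p x ->
  wconv (neg (c j)) (restr f) s x = 0.
Proof.
move=> bf px; have bc := bounded_pow_weight j.
rewrite /wconv -[RHS](wint0 (neg (c j))); apply: wint_neg_eq => //.
  by apply: bounded_shift2; exact: bounded_restr.
move=> u y _ py; rewrite /shift2 /restr.
by case: px => [->|px]; rewrite ?add0r ?(negbTE py) ?(negbTE (npD px py)) mulr0.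
Qed.

(* Wiener-Hopf factorization, one power of the step measure at a time: the
   contributions of [neg] weights live on the complement of [p] and die
   after restriction. *)
Let spitzer_step n f : bounded_fun2 f -> vanishes_after b f ->
  \sum_(j < n.+1) occF (n - j) (wconv (pos_weight j) f) =
  \sum_(j < n) occF (n - j.+1) (wconv (pos_weight j) (wconv one (restr f)))
  + occF n.+1 f.
Proof.
move=> bf f0; have bc := bounded_pow_weight.
have bnc j : bounded_weight (neg (c j)) by exact: bounded_neg.
have brf := bounded_restr bf; have rf0 := vanishes_restr f0.
have bNf : bounded_fun2 (wconv one (restr f)) by exact: bounded_wconv.
have posE m j g : bounded_fun2 g -> occF m (wconv (pos_weight j) g) =
    occF m (wconv (c j) g) - occF m (wconv (neg (c j)) g).
  move=> bg; rewrite -occ_functionalB; try exact: bounded_wconv.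
  congr (occF m _); apply/funext => s; apply/funext => x; rewrite /wconv.
  by rewrite (@wint_split (c j)) ?addrK//; exact: bounded_shift2.
(* The sum of u_j - v_j is regrouped into u_(i+1) - v_i. Both then contain the factor N explicitly,
   in u from the extra convolution power and in v from the extra step of [W], so their difference is
   again a [pos_weight] term. *)
pose u j := occF (n - j) (wconv (c j) (restr f)).
pose v j := occF (n - j) (wconv (neg (c j)) (restr f)).
have telescope (e : nat -> R) : (forall i, (i < n)%N -> u i.+1 - v i = e i) -> v n = 0 ->
    \sum_(j < n.+1) (u j - v j) = \sum_(j < n) e j + u 0%N.
  move: u v => u v uv vn; rewrite sumrB big_ord_recl big_ord_recr/= vn addr0.
  by rewrite -addrA -sumrB addrC; congr (_ + _); apply: eq_bigr => i _; exact: uv.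
have u0 : u 0%N = occF n.+1 f.
  rewrite /u subn0; apply: etrans (occF_step n brf rf0) _.
  by rewrite wint_neg_restr// addr0 !occ_functionalS wint_pos_restr.
rewrite -u0.
apply: etrans (telescope (fun i => occF (n - i.+1)
  (wconv (pos_weight i) (wconv one (restr f)))) _ _).
- by apply: eq_bigr => j _; rewrite occF_pos_restr// posE.
- move=> i ni.
  set m := (n - i.+1)%N.
  have mE : (n - i = m.+1)%N by rewrite /m subnSK.
  have -> : u i.+1 = occF m (wconv (c i) (wconv one (restr f))).
    exact: (wconv_pow_step m i brf rf0).
  have -> : v i = occF m (wconv (neg (c i)) (wconv one (restr f))).
    rewrite /v mE -(wconv_commute (bnc i) brf).
    have bw := bounded_wconv LY b (bnc i) brf.
    have vw := vanishes_wconv (bnc i) brf rf0.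
    rewrite (occF_step m bw vw).
    have -> : wint (neg (occ m)) (wconv (neg (c i)) (restr f)) = 0.
      apply: etrans (wint0 (neg (occ m))).
      apply: (wint_neg_eq (bounded_occ_w m) bw bounded_zero2) => s x _ px.
      by apply: wconv_neg_restr => //; right.
    by rewrite addr0.
  by rewrite (posE m i _ bNf).
- by rewrite /v subnn occ_functional0; apply: wconv_neg_restr => //; left.
Qed.

(** The induction hypothesis is applied to [wconv one (restr f)]: one more step of N followed by
    restriction turns [W_n] into [W_(n+1)], giving n copies of it, and [spitzer_step] supplies the
    last one. *)
Theorem spitzer n f : bounded_fun2 f -> vanishes_after b f ->
  n%:R * occF n f = \sum_(j < n) occF (n - j.+1) (wconv (pos_weight j) f).
Proof.
elim: n f => [|n IH] f bf f0; first by rewrite big_ord0 mul0r.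
have brf := bounded_restr bf; have rf0 := vanishes_restr f0.
under eq_bigr do rewrite subSS.
rewrite spitzer_step// -IH; [|exact: bounded_wconv|exact: vanishes_wconv].
rewrite occF_step// wint_neg_restr// addr0 !occ_functionalS wint_pos_restr//.
by rewrite mulrS mulrDl mul1r addrC.
Qed.

End spitzer_identity.

(** * Convolutions in time and sums over partitions *)

Section time_convolution.
Context {R : realType}.
Variable b : R.
Local Notation lam := (lebesgue_segment b).
Implicit Types (f g phi : R -> R) (fs : seq (R -> R)).

Definition null_after phi := forall s, b < s -> phi s = 0.

(** The adjoint of convolution with [f] in the time variable; unlike nested convolutions, these
    operators visibly commute. *)
Definition time_shift_integral f phi s := \int[lam]_u (f u * phi (s + u)).
Local Notation tsi := time_shift_integral.

(** The indicator moves the dependence on t from the domain into the integrand, so that Fubini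
    applies on the fixed finite measure [lam]. *)
Definition truncated_conv f g t := \int[lam]_s ((s <= t)%R%:R * (f (t - s) * g s)).

Lemma bounded_time_shift f phi : bounded_mfun f -> bounded_mfun phi -> bounded_mfun (tsi f phi).
Proof.
move=> bf bphi.
by apply: (bounded_mfun_Rintegral (F := fun s u : R => f u * phi (s + u))); solve_bounded.
Qed.

Lemma null_time_shift f phi : bounded_mfun f -> bounded_mfun phi -> null_after phi ->
  null_after (tsi f phi).
Proof.
move=> bf bphi phi0 s bs.
rewrite /tsi -[RHS](mul0r (fine (lam setT))) -Rintegral_cst//.
apply: eq_lebesgue_segment => [||u /andP[u0 _]]; first by solve_bounded.
- exact: bounded_mfun_cst.
- by rewrite phi0 ?mulr0//; lra.
Qed.

Lemma time_shiftZ a f phi : bounded_mfun f -> bounded_mfun phi ->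
  tsi (fun u => a * f u) phi = (fun s => a * tsi f phi s).
Proof.
move=> bf bphi; apply/funext => s; rewrite /tsi -bounded_RintegralZl; last by solve_bounded.
by apply: eq_Rintegral => u _; rewrite mulrA.
Qed.

Lemma time_shift_commute f g phi : bounded_mfun f -> bounded_mfun g -> bounded_mfun phi ->
  tsi f (tsi g phi) = tsi g (tsi f phi).
Proof.
move=> bf bg bphi; apply/funext => s; rewrite /tsi.
transitivity (\int[lam]_u \int[lam]_v (f u * (g v * phi (s + u + v)))).
  by apply: eq_Rintegral => u _; rewrite bounded_RintegralZl//; solve_bounded.
rewrite (bounded_Rintegral_swap (F := fun u v : R => f u * (g v * phi (s + u + v)))); last by solve_bounded.
apply: eq_Rintegral => v _; rewrite -bounded_RintegralZl; last by solve_bounded.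
by apply: eq_Rintegral => u _; rewrite mulrCA addrAC.
Qed.

Lemma bounded_truncated_conv f g : bounded_mfun f -> bounded_mfun g ->
  bounded_mfun (truncated_conv f g).
Proof.
move=> bf bg; apply: (bounded_mfun_Rintegral (F := fun t s : R => (s <= t)%R%:R * (f (t - s) * g s))).
by solve_bounded.
Qed.

Lemma truncated_conv_integral f g phi : bounded_mfun f -> bounded_mfun g ->
  bounded_mfun phi -> null_after phi ->
  \int[lam]_t (truncated_conv f g t * phi t) = \int[lam]_u (g u * tsi f phi u).
Proof.
move=> bf bg bphi phi0.
transitivity (\int[lam]_t \int[lam]_u ((u <= t)%R%:R * (f (t - u) * g u) * phi t)).
  by apply: eq_Rintegral => t _; rewrite bounded_RintegralZr//; solve_bounded.
rewrite (bounded_Rintegral_swap (F := fun t u : R => (u <= t)%R%:R * (f (t - u) * g u) * phi t)); last by solve_bounded.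
apply: eq_lebesgue_segment => [||u /andP[u0 _]].
- apply: (bounded_mfun_Rintegral (F := fun u t : R => (u <= t)%R%:R * (f (t - u) * g u) * phi t)).
  by solve_bounded.
- by have bt := bounded_time_shift bf bphi; solve_bounded.
pose G v := f (v - u) * g u * phi v.
have bG : bounded_mfun G by solve_bounded.
have G0 v : b < v -> G v = 0 by move=> bv; rewrite /G phi0 ?mulr0.
transitivity (\int[lam]_t ((u <= t)%R%:R * G t)).
  by apply: eq_Rintegral => t _; rewrite /G !mulrA.
rewrite -(lebesgue_segment_shift u0 bG G0) /tsi -bounded_RintegralZl; last by solve_bounded.
by apply: eq_Rintegral => r _; rewrite /G [u + r - u]addrAC subrr add0r; ring.
Qed.

(** The kernels of the partition formula are controlled only on [0, b], since X is assumed
    measurable at nonnegative times only; [f'] and [g'] are bounded measurable functions agreeing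
    with them there. *)
Lemma conv_truncated f f' g g' t : bounded_mfun f' -> bounded_mfun g' ->
  (forall s, 0 <= s <= b -> f s = f' s) -> (forall s, 0 <= s <= b -> g s = g' s) ->
  0 <= t <= b -> Defs.conv f g t = truncated_conv f' g' t.
Proof.
move=> bf bg ff gg /andP[t0 tb]; rewrite /truncated_conv lebesgue_segmentE; last by solve_bounded.
rewrite /Defs.conv Rintegral_mkcond [RHS]Rintegral_mkcond; congr (Rintegral _ _ _).
apply/funext => s; rewrite !patchE !mem_setE/= !in_itv/=.
case: (lerP 0 s) => //= s0; case: (lerP s t) => st; last by rewrite mul0r if_same.
by rewrite (le_trans st tb) mul1r ff ?gg//; apply/andP; split; lra.
Qed.

Fixpoint truncated_bigconv fs : R -> R :=
  match fs with
  | [::] => fun _ => 0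
  | [:: f] => f
  | f :: fs' => truncated_conv f (truncated_bigconv fs')
  end.

End time_convolution.

(** * Sums over set partitions and subsets *)

Section set_partition_sums.
Variables (T : finType) (V : nmodType).
Implicit Types (D B C : {set T}) (rho : {set {set T}}).

Lemma sum_partition_pblock (G : {set {set T}} -> V) D x : x \in D ->
  \sum_(rho | finset.partition rho D) G rho =
  \sum_(B : {set T} | (x \in B) && (B \subset D))
    \sum_(rho | finset.partition rho (D :\: B)) G (B |: rho)%SET.
Proof.
move=> xD.
rewrite (partition_big (fun rho => finset.pblock rho x)
  (fun B : {set T} => (x \in B) && (B \subset D))) => [|rho prho]; last first.
  have /and3P[/eqP covD tI _] := prho.
  rewrite mem_pblock covD xD/= -covD; apply: (bigcup_max (finset.pblock rho x)) => //.
  by rewrite pblock_mem// covD.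
apply: eq_bigr => B /andP[xB BD].
rewrite (reindex_onto (fun rho => B |: rho)%SET (fun rho => rho :\ B)%SET); last first.
  move=> rho /andP[prho /eqP <-]; rewrite finset.setD1K// pblock_mem//.
  by rewrite (cover_partition prho).
apply: eq_bigl => rho; apply/idP/idP.
  move=> /andP[/andP[pD _] /eqP <-].
  by apply: partitionD1 => //; rewrite finset.setU11.
move=> prho.
have B0 : B != finset.set0 by apply/set0Pn; exists x.
have BD' : fintype.disjoint (mem B) (mem (D :\: B)%SET).
  by rewrite -finset.setI_eq0; apply/eqP/setP => y; rewrite !inE; case: (y \in B).
have pD : finset.partition (B |: rho)%SET D.
  have := partitionU1 prho B0 BD'; congr (finset.partition _ _).
  apply/setP => y; rewrite !inE; case: (boolP (y \in B)) => //= yB.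
  by rewrite (fintype.subsetP BD).
have Brho : B \notin rho.
  apply/negP => Brho; have /fintype.subsetP/(_ x xB) := partitionS prho Brho.
  by rewrite inE xB.
by rewrite pD finset.setU1K// eqxx andbT (def_pblock _ (setU11 _ _) xB) ?(partition_trivIset pD)/=.
Qed.

Lemma sum_subset_card (h : nat -> V) D :
  \sum_(C : {set T} | C \subset D) h #|C| = \sum_(k < #|D|.+1) h k *+ 'C(#|D|, k).
Proof.
rewrite (partition_big (fun C : {set T} => inord #|C| : 'I_#|D|.+1) predT)//.
apply: eq_bigr => k _; rewrite -cards_draws -sumr_const.
apply: congr_big => // [C|C]; last first.
  by move=> /andP[CD /eqP <-]; rewrite inordK// ltnS subset_leq_card.
rewrite inE; case: (boolP (C \subset D)) => //= CD.
by rewrite -val_eqE/= inordK// ltnS subset_leq_card.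
Qed.

Lemma sum_subset_containing (g : nat -> V) D x : x \in D ->
  \sum_(B : {set T} | (x \in B) && (B \subset D)) g #|B| =
  \sum_(k < #|D|) g k.+1 *+ 'C(#|D|.-1, k).
Proof.
move=> xD; have cD : #|D| = #|(D :\ x)%SET|.+1 by rewrite (cardsD1 x) xD.
rewrite cD -(sum_subset_card (fun k => g k.+1)).
rewrite (reindex_onto (fun C => x |: C)%SET (fun C => C :\ x)%SET); last first.
  by move=> B /andP[xB _]; rewrite finset.setD1K.
apply: congr_big => // [C|C].
  rewrite finset.setU11/= finset.subUset finset.sub1set xD/= finset.subsetD1.
  case: (boolP (x \in C)) => xC; last by rewrite finset.setU1K// eqxx !andbT.
  rewrite andbF; apply/negbTE; rewrite negb_and; apply/orP; right.
  by apply/eqP => /setP /(_ x); rewrite !inE eqxx xC.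
by move=> /andP[_ /eqP CE]; rewrite cardsU1 -{1}CE !inE eqxx.
Qed.

End set_partition_sums.

(** * Moments of the occupation time *)

Section iterated_convolution.
Context {R : realType}.
Variable b : R.
Local Notation lam := (lebesgue_segment b).
Local Notation tsi := (time_shift_integral b).
Local Notation null_after := (null_after b).
Variables (I : eqType) (F : I -> R -> R).
Hypothesis bF : forall i, bounded_mfun (F i).
Implicit Types (s : seq I) (phi : R -> R).

Definition iter_shift s phi := foldr (fun i => tsi (F i)) phi s.

Lemma bounded_iter_shift s phi : bounded_mfun phi -> bounded_mfun (iter_shift s phi).
Proof. by move=> bphi; elim: s => //= i s IH; exact: bounded_time_shift. Qed.

Lemma iter_shift_commute i s phi : bounded_mfun phi ->
  tsi (F i) (iter_shift s phi) = iter_shift s (tsi (F i) phi).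
Proof.
move=> bphi; elim: s => //= j s IH.
by rewrite (time_shift_commute b (bF i) (bF j) (bounded_iter_shift s bphi)) IH.
Qed.

(** Needed because the enumeration of a set of blocks has no prescribed order, so adding a block may
    insert it anywhere. *)
Lemma iter_shift_perm s s' phi : bounded_mfun phi -> perm_eq s s' ->
  iter_shift s phi = iter_shift s' phi.
Proof.
move=> bphi; have iter_rem i r : i \in r ->
    iter_shift r phi = tsi (F i) (iter_shift (rem i r) phi).
  elim: r => //= j r IH; rewrite inE eq_sym; case: eqVneq => [->//|_ /= ir].
  rewrite (IH ir).
  exact: time_shift_commute (bounded_iter_shift (rem i r) bphi).
elim: s s' => [|i s IH] s' ss'; first by move: ss'; rewrite perm_sym => /perm_nilP ->.
have is' : i \in s' by rewrite -(perm_mem ss') mem_head.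
rewrite (iter_rem _ _ is') /= (IH (rem i s'))//.
by rewrite -(perm_cons i) (perm_trans ss')// perm_to_rem.
Qed.

Lemma truncated_bigconv_cons i j s : truncated_bigconv b (map F [:: i, j & s]) =
  truncated_conv b (F i) (truncated_bigconv b (map F (j :: s))).
Proof. by []. Qed.

Lemma bounded_truncated_bigconv s : bounded_mfun (truncated_bigconv b (map F s)).
Proof.
elim: s => [|i [|j s] IH]; [exact: bounded_mfun_cst|exact: bF|].
by rewrite truncated_bigconv_cons; exact: bounded_truncated_conv.
Qed.

(** The list is nonempty because the empty convolution is set to 0, whereas the empty iterated shift
    is the identity. *)
Lemma truncated_bigconv_integral i s phi : bounded_mfun phi -> null_after phi ->
  \int[lam]_t (truncated_bigconv b (map F (i :: s)) t * phi t) = iter_shift (i :: s) phi 0.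
Proof.
elim: s i phi => [|j s IH] i phi bphi phi0.
  by rewrite /= /time_shift_integral; apply: eq_Rintegral => t _; rewrite add0r.
have bj := bounded_truncated_bigconv (j :: s).
have bt := bounded_time_shift b (bF i) bphi.
have nt := null_time_shift (bF i) bphi phi0.
rewrite truncated_bigconv_cons (truncated_conv_integral (bF i) bj bphi phi0) (IH j _ bt nt).
by rewrite -iter_shift_commute.
Qed.

Lemma bigconv_truncated (G : I -> R -> R) s t :
  (forall i u, 0 <= u <= b -> G i u = F i u) -> 0 <= t <= b ->
  bigconv (map G s) t = truncated_bigconv b (map F s) t.
Proof.
move=> GF; elim: s t => [|i [|j s] IH] t tb //; first exact: GF.
rewrite truncated_bigconv_cons -[LHS]/(Defs.conv (G i) (bigconv (map G (j :: s))) t).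
have bj := bounded_truncated_bigconv (j :: s).
by apply: conv_truncated => // u ub; exact: GF.
Qed.

Lemma bigconv_integral (G : I -> R -> R) i s :
  (forall j u, 0 <= u <= b -> G j u = F j u) ->
  Rintegral lebesgue_measure `[0, b] (bigconv (map G (i :: s))) =
  iter_shift (i :: s) (fun t => (t <= b)%R%:R) 0.
Proof.
move=> GF; rewrite -truncated_bigconv_integral; last 2 first.
- by solve_bounded.
- by move=> t; rewrite ltNge => /negbTE ->.
have bi := bounded_truncated_bigconv (i :: s).
rewrite lebesgue_segmentE; last by solve_bounded.
apply: eq_Rintegral => t; rewrite inE/= in_itv/= => tb.
by have /andP[_ ->] := tb; rewrite mulr1; exact: (bigconv_truncated (i :: s) GF tb).
Qed.

End iterated_convolution.

Section occupation_moments.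
Context {d : measure_display} {W : measurableType d} {R : realType}.
Variables (P : probability W R) (Y : R -> W -> R).
Hypothesis LY : levy_like P Y.
Variables (b : R) (p : R -> bool).
Hypothesis b0 : 0 <= b.
Hypothesis mp : measurable_fun setT p.
Hypothesis pD : forall x y, p x -> p y -> p (x + y).
Hypothesis npD : forall x y, ~~ p x -> ~~ p y -> ~~ p (x + y).
Local Notation lam := (lebesgue_segment b).
Local Notation tsi := (time_shift_integral b).
Local Notation null_after := (null_after b).
Implicit Types phi : R -> R.

Definition pos_prob u : R := \int[P]_w (p (Y u w))%:R.
Definition pos_kernel j u : R := iterint b (fun=> 1) j u * pos_prob u.
(** The time marginal of [W_n]: test functions that ignore the position. *)
Definition time_functional n phi : R := occ_functional P Y b p n (fun s _ => phi s).

Lemma bounded_pos_prob : bounded_mfun pos_prob.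
Proof.
apply: (bounded_mfun_Rintegral (F := fun u w => (p (Y u w))%:R)).
by solve_bounded.
Qed.

Lemma bounded_pos_kernel j : bounded_mfun (pos_kernel j).
Proof.
apply: bounded_mfunM; last exact: bounded_pos_prob.
exact: (bounded_iterint b j (bounded_mfun_cst 1)).
Qed.

Lemma pos_kernelE j u : 0 <= u <= b -> pos_kernel j u = u ^+ j * pos_prob u / j`!%:R.
Proof.
move=> ub; rewrite /pos_kernel iterintE; last exact: bounded_mfun_cst.
rewrite iterint_succ (_ : \int[lam]_s _ = u); first by rewrite mulrAC.
rewrite -[RHS](lebesgue_segment_length ub); apply: eq_Rintegral => s _.
by rewrite -[iterint _ _ 0 _]/1 !mulr1.
Qed.

Lemma wconv_pos_weight j phi : bounded_mfun phi ->
  wconv P Y b (pos_weight Y b p j) (fun s _ => phi s) = fun s _ => tsi (pos_kernel j) phi s.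
Proof.
move=> bphi; apply/funext => s; apply/funext => x.
apply: eq_Rintegral => u _.
transitivity (\int[P]_w ((p (Y u w))%:R * (iterint b (fun=> 1) j u * phi (s + u)))).
  by apply: eq_Rintegral => w _; rewrite /pos_weight /pow_weight /shift2 mulrA.
rewrite bounded_RintegralZr; last by solve_bounded.
by rewrite -[X in X * _]/(pos_prob u) /pos_kernel; ring.
Qed.

Let bounded_time phi : bounded_mfun phi -> bounded_fun2 (fun s (_ : R) => phi s).
Proof. by rewrite /bounded_fun2 => bphi; solve_bounded. Qed.

Let bounded_pos_occ n : bounded_weight (fun s w => (p (Y s w))%:R * occ Y b p n s w).
Proof.
by have bo := bounded_occ LY b mp n; rewrite /bounded_weight; solve_bounded.
Qed.

Lemma time_functionalZ n a phi : bounded_mfun phi ->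
  time_functional n (fun s => a * phi s) = a * time_functional n phi.
Proof.
move=> bphi; case: n => [//|n].
exact: (wintZ LY b a (bounded_pos_occ n) (bounded_time bphi)).
Qed.

Lemma time_functional_rec n phi : bounded_mfun phi -> null_after phi ->
  n%:R * time_functional n phi =
  \sum_(j < n) time_functional (n - j.+1) (tsi (pos_kernel j) phi).
Proof.
move=> bphi phi0.
apply: etrans (spitzer LY b0 mp pD npD n (bounded_time bphi) _) _; first by move=> s x; exact: phi0.
by apply: eq_bigr => j _; rewrite wconv_pos_weight.
Qed.


Lemma time_functional1 phi : bounded_mfun phi -> null_after phi ->
  time_functional 1 phi = tsi (pos_kernel 0) phi 0.
Proof.
move=> bphi phi0; have := time_functional_rec 1 bphi phi0.
by rewrite mul1r big_ord1.
Qed.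

(** The factorial cancels the denominator in [pos_kernel], leaving u^(#|B| - 1) times the
    probability on [0, b]. *)
Definition block_kernel m (B : {set 'I_m}) u : R :=
  (#|B| - 1)`!%:R * pos_kernel (#|B| - 1) u.

Lemma bounded_block_kernel m (B : {set 'I_m}) : bounded_mfun (block_kernel B).
Proof. by have bk := bounded_pos_kernel (#|B| - 1); solve_bounded. Qed.

(* Peeling off the block of a fixed element turns the sum over partitions
   into the recursion [time_functional_rec]. *)
Lemma sum_partition_iter_shift m (D : {set 'I_m}) phi :
  bounded_mfun phi -> null_after phi ->
  \sum_(rho | finset.partition rho D) iter_shift b (@block_kernel m) (enum rho) phi 0 =
  (#|D|)`!%:R * time_functional #|D| phi.
Proof.
have [n] := ubnP #|D|; elim: n D phi => // n IH D phi; rewrite ltnS => Dn bphi phi0.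
have [->|] := eqVneq D finset.set0; last move=> /set0Pn[x xD].
  rewrite (eq_bigl (pred1 finset.set0)) => [|rho]; last exact: partition_set0.
  by rewrite big_pred1_eq cards0 mul1r enum_set0.
have D0 : (0 < #|D|)%N by rewrite card_gt0; apply/set0Pn; exists x.
(* The contribution of a block of size k through x: the first factorial comes from the induction
   hypothesis on the remaining elements, the second from [block_kernel]. *)
pose g k := (#|D| - k)`!%:R *
  ((k - 1)`!%:R * time_functional (#|D| - k) (tsi (pos_kernel (k - 1)) phi)).
rewrite (sum_partition_pblock _ xD).
transitivity (\sum_(B : {set 'I_m} | (x \in B) && (B \subset D)) g #|B|).
  apply: eq_bigr => B /andP[xB BD].
  have bB := bounded_block_kernel B.
  have cB : #|(D :\: B)%SET| = (#|D| - #|B|)%N.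
    by rewrite cardsD (finset.setIidPr BD).
  have B0 : (0 < #|B|)%N by rewrite card_gt0; apply/set0Pn; exists x.
  have bt := bounded_time_shift b bB bphi.
  have nt := null_time_shift bB bphi phi0.
  transitivity (\sum_(rho | finset.partition rho (D :\: B)%SET)
      iter_shift b (@block_kernel m) (enum rho) (tsi (block_kernel B) phi) 0).
    apply: eq_bigr => rho prho.
    have Brho : B \notin rho.
      apply/negP => Brho; have /fintype.subsetP/(_ x xB) := partitionS prho Brho.
      by rewrite inE xB.
    (* The removed block is placed last, where [foldr] applies its shift directly to [phi]; the
       induction hypothesis then takes the shifted function as test function. *)
    rewrite (iter_shift_perm b (@bounded_block_kernel m) (s' := rcons (enum rho) B) bphi).
      by rewrite /iter_shift foldr_rcons.
    apply: uniq_perm; rewrite ?rcons_uniq ?enum_uniq ?mem_enum ?Brho// => C.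
    by rewrite mem_rcons inE !mem_enum in_setU1.
  rewrite (IH _ _ _ bt nt) cB; last first.
    by rewrite (leq_trans _ Dn)// ltn_subrL B0 D0.
  have bk := bounded_pos_kernel (#|B| - 1).
  by rewrite /block_kernel (time_shiftZ _ _ bk bphi) time_functionalZ//; exact: bounded_time_shift.
rewrite (sum_subset_containing g xD).
transitivity ((#|D|.-1)`!%:R * (#|D|%:R * time_functional #|D| phi)); last first.
  by rewrite mulrA -natrM mulnC -{1}(prednK D0) -factS prednK.
rewrite (time_functional_rec _ bphi phi0) mulr_sumr; apply: eq_bigr => k _.
have kD : (k <= #|D|.-1)%N by rewrite -ltnS prednK.
(* With D the number of elements, [bin_fact] gives C(D-1, k) k! (D-1-k)! = (D-1)!, so all block
   sizes get the same factor. *)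
rewrite /g subn1 /= -[_ *+ 'C(_, _)]mulr_natl 2!mulrA -!natrM -(bin_fact kD).
have -> : (#|D|.-1 - k = #|D| - k.+1)%N by rewrite -subn1 -subnDA add1n.
by rewrite -mulnA [(k`! * _)%N]mulnC.
Qed.

(** The indicator of t <= b yields the total mass on [0, b] and still vanishes after b, as the
    recursion demands. *)
Lemma Rintegral_occ_pow n : \int[P]_w (occ Y b p 1 b w) ^+ n.+1 =
  (n.+1)`!%:R * time_functional n.+1 (fun t => (t <= b)%R%:R).
Proof.
have bo m := bounded_occ LY b mp m.
have bom m : bounded_mfun (occ Y b p m b) by exact: bounded_mfun_slice1 (bo m) b.
transitivity (\int[P]_w ((n.+1)`!%:R * occ Y b p n.+1 b w)).
  apply: eq_Rintegral => w _.
  have bp : bounded_mfun (fun r => (p (Y r w))%:R : R) by solve_bounded.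
  have f0 : (n.+1)`!%:R != 0 :> R by rewrite pnatr_eq0 -lt0n fact_gt0.
  rewrite [in RHS]/occ (iterintE b n.+1 b bp) mulrCA mulfV// mulr1.
  by [].
rewrite bounded_RintegralZl//; congr (_ * _).
have bon := bo n.
transitivity (\int[P]_w \int[lam]_s ((p (Y s w))%:R * occ Y b p n s w * (s <= b)%R%:R)).
  by apply: eq_Rintegral => w _; rewrite occS; apply: eq_Rintegral => s _; rewrite -mulrA mulrC.
exact: (bounded_Rintegral_swap (F := fun w (s : R) =>
  (p (Y s w))%:R * occ Y b p n s w * (s <= b)%R%:R) ltac:(solve_bounded)).
Qed.

End occupation_moments.

Unset Implicit Arguments.
Set Strict Implicit.

Theorem mainTheorem11 (d : measure_display) (T : measurableType d) (R : realType)
    (P : probability T R) (X : R -> T -> R) :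
  levy_process P X ->
  forall p : R -> bool, (p = (fun x => 0 < x)) \/ (p = (fun x => 0 <= x)) ->
  let q := fun u : R => fine (P [set w | p (X u w)]) in
  forall t : R, 0 < t ->
  [/\ (forall m : nat, (1 <= m)%N ->
         occ_moment P X p t m = (partition_formula q m t)%:E),
      occ_moment P X p t 1 = (Rintegral lebesgue_measure `[0, t] q)%:E &
      occ_moment P X p t 2 =
        (Rintegral lebesgue_measure `[0, t] (fun s => s * q s)
         + Rintegral lebesgue_measure `[0, t]
             (fun s => Rintegral lebesgue_measure `[0, s]
                         (fun u => q u * q (s - u))))%:E].
Proof.
move=> LX p pE q t t0; have LY := levy_process_levy_like LX.
set Y := (fun s => X (Num.max s 0)) in LY; have t0' := ltW t0.
have mp : measurable_fun setT p by case: pE => ->; solve_measurable.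
have pD x y : p x -> p y -> p (x + y).
  by case: pE => -> => [|] x0 y0; [exact: addr_gt0|exact: addr_ge0].
have npD x y : ~~ p x -> ~~ p y -> ~~ p (x + y).
  by case: pE => ->; rewrite -?leNgt -?ltNge => x0 y0; lra.
have qE u : 0 <= u <= t -> pos_prob P Y p u = q u.
  move=> /andP[u0 _]; rewrite /pos_prob /q /Rintegral /Y max_l//; congr fine.
  have mA : measurable [set w | p (X u w)].
    have [[mX _] _ _ _] := LX; rewrite -[X in measurable X]setTI.
    have mpX : measurable_fun setT (fun w => p (X u w)) by exact: measurableT_comp mp (mX u u0).
    exact: (mpX measurableT [set true]).
  transitivity (\int[P]_w (\1_[set w | p (X u w)] w)%:E)%E; last by rewrite integral_indic// setIT.
  by apply: eq_integral => w _; rewrite indicE mem_setE.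
have kE j u : 0 <= u <= t -> pos_kernel P Y t p j u = u ^+ j * q u / j`!%:R.
  by move=> ut; rewrite pos_kernelE// qE.
have occE w : occupation_time X p t w = occ Y t p 1 t w.
  rewrite occS lebesgue_segmentE; last by solve_bounded.
  apply: eq_Rintegral => s; rewrite inE/= in_itv/= => /andP[s0 st].
  by rewrite st mul1r -[occ _ _ _ 0 _ _]/1 mulr1 /Y max_l.
pose phi s : R := (s <= t)%R%:R.
have bphi : bounded_mfun phi by solve_bounded.
have phi0 : null_after t phi by move=> s; rewrite /phi ltNge => /negbTE ->.
have momentE n : occ_moment P X p t n.+1 =
    ((n.+1)`!%:R * time_functional P Y t p n.+1 phi)%:E.
  rewrite /occ_moment; under eq_integral do rewrite occE.
  rewrite -(Rintegral_occ_pow LY t mp) bounded_EFin_Rintegral//.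
  apply: bounded_mfunX; exact: bounded_mfun_slice1 (bounded_occ LY t mp 1) t.
(* The second moment needs only block sizes 1 and 2; the boolean, coerced to 0 or 1, is the exponent
   of u. *)
pose K (c : bool) := pos_kernel P Y t p c.
have bK c : bounded_mfun (K c) by exact: bounded_pos_kernel.
pose G (c : bool) u := if c then u * q u else q u.
have GK c u : 0 <= u <= t -> G c u = K c u.
  by move=> ut; rewrite /K kE// /G; case: c; rewrite ?expr1 ?expr0 ?mul1r divr1.
split.
- case=> // n _; rewrite momentE; congr EFin.
  have := sum_partition_iter_shift LY t0' mp pD npD [set: 'I_n.+1]%SET bphi phi0.
  rewrite cardsT card_ord => <-; apply: eq_bigr => rho prho.
  (* The ground set is nonempty, so a partition of it has at least one block. *)
  case E: (enum rho) => [|B s].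
    have : ord0 \in finset.cover rho by rewrite (cover_partition prho) inE.
    by move=> /finset.bigcupP[B]; rewrite -mem_enum E.
  have GE (C : {set 'I_n.+1}) u : 0 <= u <= t ->
      u ^+ (#|C| - 1) * q u = block_kernel P Y t p C u.
    by move=> ut; rewrite /block_kernel kE// [RHS]mulrC divfK// pnatr_eq0 -lt0n fact_gt0.
  exact: esym (bigconv_integral (bounded_block_kernel LY t mp (m := n.+1)) B s GE).
- rewrite momentE mul1r (time_functional1 LY t0' mp pD npD bphi phi0); congr EFin.
  exact: esym (bigconv_integral bK false [::] GK).
(* Here 2! is exactly the factor 2 of the recursion. The term j = 1 is the partition into one block
   of size 2, the term j = 0 the partition into two singletons. *)
- rewrite momentE; congr EFin; rewrite (time_functional_rec LY t0' mp pD npD 2 bphi phi0).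
  rewrite big_ord_recl big_ord1 /= addrC; congr (_ + _).
    exact: esym (bigconv_integral bK true [::] GK).
  have bk := bounded_pos_kernel LY t mp 0.
  apply: etrans (time_functional1 LY t0' mp pD npD (bounded_time_shift t bk bphi)
    (null_time_shift bk bphi phi0)) _.
  apply: etrans (esym (bigconv_integral bK false [:: false] GK)) _.
  by apply: eq_Rintegral => s _; apply: eq_Rintegral => u _; rewrite mulrC.
Qed.
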